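(* Given a graph $G$ with $n$ vertices, $m$ edges and $\operatorname{pg}(G)=\gamma$ (and the value $\gamma$), a shortest path of $G$ whose eccentricity is minimum among all shortest paths of $G$ can be found in $\mathcal{O}(n^{\gamma+4})$ time if $\gamma\ge 2$, in $\mathcal{O}(n^3m)$ time if $\gamma=1$, and in $\mathcal{O}(n^2m)$ time if $\gamma=0$.
   Context: Graphs are finite, connected, unweighted, undirected and simple. $d_G$ denotes shortest-path distance, $d_G(v,S)=\min_{u\in S}d_G(u,v)$, $\operatorname{ecc}(S)=\max_{u\in V}d_G(u,S)$. $\Pr(x,S)=\{u\in S\mid d_G(u,x)=d_G(x,S)\}$. Projection gap: for an integer $\gamma\ge 0$, $G$ has projection gap at most $\gamma$ if for every shortest path $P=(v_0,\dots,v_l)$ (with $d_G(v_0,v_i)=i$), every vertex $x$ and every $v_i,v_k\in\Pr(x,P)$ with $i<k$, $d_G(v_i,v_k)>\gamma+1$ implies there is $v_j\in\Pr(x,P)$ with $i<j<k$; $\operatorname{pg}(G)$ is the least such $\gamma$. *)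

(* Defs.v *)
From mathcomp Require Import all_boot.

Set Implicit Arguments.
Unset Strict Implicit.
Unset Printing Implicit Defensive.

(** ** Graphs, given by their adjacency relation [e : rel T] *)

Definition edges (T : finType) (e : rel T) : {set {set T}} :=
  [set [set uv.1; uv.2] | uv : T * T & e uv.1 uv.2].

(* The least length of a walk from [u] to [v].  In a connected graph it is
   smaller than [#|T|]; [find] returns [#|T|] when there is no such walk. *)
Definition dist (T : finType) (e : rel T) (u v : T) : nat :=
  find (fun l => [exists w : l.-tuple T, path e u w && (last u w == v)])
       (iota 0 #|T|).

(* As distances in a connected graph are smaller than [#|T|], the default value
   of the minimum is reached only for empty [S]. *)
Definition dist_set (T : finType) (e : rel T) (v : T) (S : {set T}) : nat :=
  \big[minn/#|T|]_(u in S) dist e u v.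

Definition ecc (T : finType) (e : rel T) (S : {set T}) : nat :=
  \max_(u : T) dist_set e u S.

Definition Pr (T : finType) (e : rel T) (x : T) (S : {set T}) : {set T} :=
  [set u in S | dist e u x == dist_set e x S].

Definition shortest_path (T : finType) (e : rel T) (P : seq T) : Prop :=
  if P is v0 :: P' then
    path e v0 P' /\ forall i, i < size P -> dist e v0 (nth v0 P i) = i
  else False.

Definition proj_gap_le (T : finType) (e : rel T) (g : nat) : Prop :=
  forall P : seq T, shortest_path e P ->
  forall (x : T) (i k : nat), i < k -> k < size P ->
    let v := nth x P in
    let PrxP := Pr e x [set u in P] in
    v i \in PrxP -> v k \in PrxP -> g + 1 < dist e (v i) (v k) ->
    exists j, [/\ i < j, j < k & v j \in PrxP].

(* [pg(G) = g] *)
Definition is_proj_gap (T : finType) (e : rel T) (g : nat) : Prop :=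
  proj_gap_le e g /\ forall g', proj_gap_le e g' -> g <= g'.

Definition min_ecc_shortest_path (T : finType) (e : rel T) (P : seq T) : Prop :=
  shortest_path e P /\
  forall Q, shortest_path e Q -> ecc e [set u in P] <= ecc e [set u in Q].

(** ** Model of computation

    Structured programs for the uniform-cost random access machine: finitely
    many registers, an infinite memory with indirect addressing, natural numbers
    as words, and addition and truncated subtraction as the only arithmetic
    (unit-cost multiplication of unbounded integers would be unrealistic). Every
    operation costs one unit of time. *)

Inductive expr : Type :=
| Const of nat
| Reg of nat
| Mem of expr
| Add of expr & expr
| Sub of expr & expr.

Inductive prog : Type :=
| Skip
| Assign of nat & expr                  (* register := value *)
| Store of expr & expr                  (* memory[address] := value *)
| Seq of prog & prog
| If of expr & expr & prog & prog       (* if a < b then _ else _ *)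
| While of expr & expr & prog.          (* while a < b do _ *)

Record state : Type := State { regs : nat -> nat; memory : nat -> nat }.

Definition update (f : nat -> nat) (a v : nat) : nat -> nat :=
  fun b => if b == a then v else f b.

Fixpoint eval (s : state) (a : expr) : nat :=
  match a with
  | Const c => c
  | Reg r => regs s r
  | Mem b => memory s (eval s b)
  | Add b c => eval s b + eval s c
  | Sub b c => eval s b - eval s c
  end.

Fixpoint cost (a : expr) : nat :=
  match a with
  | Const _ | Reg _ => 1
  | Mem b => (cost b).+1
  | Add b c | Sub b c => (cost b + cost c).+1
  end.

(* [exec A s s' t]: started in [s], [A] halts in [s'] after time [t]. *)
Inductive exec : prog -> state -> state -> nat -> Prop :=
| exec_skip s :
    exec Skip s s 1
| exec_assign s r a :
    exec (Assign r a) s (State (update (regs s) r (eval s a)) (memory s))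
         (cost a).+1
| exec_store s a b :
    exec (Store a b) s (State (regs s) (update (memory s) (eval s a) (eval s b)))
         (cost a + cost b).+1
| exec_seq A B s s' s'' t t' :
    exec A s s' t -> exec B s' s'' t' -> exec (Seq A B) s s'' (t + t')
| exec_if_true a b A B s s' t :
    eval s a < eval s b -> exec A s s' t ->
    exec (If a b A B) s s' ((cost a + cost b).+1 + t)
| exec_if_false a b A B s s' t :
    eval s b <= eval s a -> exec B s s' t ->
    exec (If a b A B) s s' ((cost a + cost b).+1 + t)
| exec_while_true a b A s s' s'' t t' :
    eval s a < eval s b -> exec A s s' t -> exec (While a b A) s' s'' t' ->
    exec (While a b A) s s'' ((cost a + cost b).+1 + t + t')
| exec_while_false a b A s :
    eval s b <= eval s a ->
    exec (While a b A) s s (cost a + cost b).+1.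

(** ** Input and output *)

(* The neighbours of each vertex are listed once, in an arbitrary order. *)
Definition adjacency_lists (n : nat) (e : rel 'I_n) (nb : 'I_n -> seq 'I_n) :
    Prop :=
  forall u, uniq (nb u) /\ forall v, (v \in nb u) = e u v.

(* Number of vertices, number of edges, projection gap; then for each vertex the
   address where its adjacency list starts, and the address where the last list
   ends; then the concatenated lists. *)
Definition encode (n m g : nat) (nb : 'I_n -> seq 'I_n) : seq nat :=
  let lists := [seq [seq val v | v <- nb u] | u <- enum 'I_n] in
  [:: n; m; g]
    ++ [seq n + 4 + sumn (take i (shape lists)) | i <- iota 0 n.+1]
    ++ flatten lists.

Definition init (input : seq nat) : state :=
  State (fun _ => 0) (fun a => nth 0 input a).

(* The memory starts with the number of vertices of [P], followed by them. *)
Definition outputs (n : nat) (s : state) (P : seq 'I_n) : Prop :=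
  mkseq (memory s) (size P).+1 = size P :: [seq val v | v <- P].

(* Main.v *)
Require Import Defs.
From mathcomp Require Import all_boot zify.

(** A shortest path [P] starting at [s] is read through a sliding window of its
    last [g + 1] vertices.  If some shortest path from [s] with window [q] comes
    closer to [x] than the window does, then by the projection gap no path with
    window [q] comes closer to [x] than [q] in any continuation: [x] is decided
    at [q], a property of [q] alone.  A vertex becomes decided along exactly one
    shift [q -> q'] of the window, and its distance to the path is then its
    distance to [q] or to the new vertex, whatever the path was before.  Hence
    the eccentricity of a path is the maximum of charges attached to its window
    shifts and of a term depending on its final window, and a bottleneck shortest
    path in the acyclic graph of windows is optimal.  There are at most
    [2 * m * n ^ g] shifts for each source and a charge takes time [O(n)], so
    the total time is [O(n ^ (g + 2) * m)]; when [g >= 2], [m <= n ^ 2] is used.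
    The distances are found by Bellman-Ford relaxation. *)

Set Implicit Arguments.
Unset Strict Implicit.
Unset Printing Implicit Defensive.

(** * Distances and shortest paths *)

(** Decidedness must depend on the window alone, although the path that comes close to [x] may
    differ from the path under consideration. Paths with the same window end in the same vertex, so
    their continuations can be exchanged ([rpath_swap]), and a witness for [M q x] carries the gap
    argument over to every path with window [q]. The witness may depend on [x], so [M] is a minimum
    taken for each [x] separately. A charge asks whether [x] is decided at the new window, which is
    known only when [M] is final there. Each source therefore needs two passes over the shifts, one
    for [M] and one for the costs. The machine only adds and subtracts: products, quotients and
    leading digits are tabulated beforehand by counting. Bellman-Ford from all sources costs
    [O(n^2 m)], which is within the smallest of the three bounds, so no faster search is needed. *)

Lemma ltn_bigmax (I : finType) (P : pred I) (F : I -> nat) k :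
  0 < k -> (forall i, P i -> F i < k) -> \max_(i | P i) F i < k.
Proof.
move=> k0 H; elim/big_ind: _ => // a b ha hb.
by rewrite gtn_max ha hb.
Qed.

Lemma bigmin_le (I : eqType) (r : seq I) (P : pred I) (F : I -> nat) a j :
  j \in r -> P j -> \big[minn/a]_(i <- r | P i) F i <= F j.
Proof.
elim: r => // i r IH; rewrite inE big_cons => /orP [/eqP <- -> | jr Pj].
  exact: geq_minl.
by case: ifP => _; rewrite ?geq_min IH ?orbT.
Qed.

Section Distance.

Variables (T : finType) (e : rel T).

Lemma dist_le_size u w : path e u w -> dist e u (last u w) <= size w.
Proof.
move=> pw; rewrite /dist; set p := fun _ => _.
case: (leqP #|T| (size w)) => hw.
  by apply: leq_trans (find_size _ _) _; rewrite size_iota.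
rewrite leqNgt; apply/negP => /(before_find 0); rewrite nth_iota // /p => /existsP [].
by exists (in_tuple w); rewrite /= pw eqxx.
Qed.

(** A walk without repeated vertices has fewer than [#|T|] edges, so the search through
    [iota 0 #|T|] succeeds. *)
Lemma dist_walk u v : connect e u v ->
  exists w, [/\ path e u w, last u w = v & size w = dist e u v].
Proof.
move=> /connectP [w0 pw0 ->]; case/shortenP: pw0 => w pw uw _.
have sw : size w < #|T|.
  by have := max_card (mem (u :: w)); rewrite (card_uniqP uw).
set p := fun l => [exists w' : l.-tuple T, path e u w' && (last u w' == last u w)].
have hp : has p (iota 0 #|T|).
  apply/hasP; exists (size w); first by rewrite mem_iota.
  by apply/existsP; exists (in_tuple w); rewrite /= pw eqxx.
have := nth_find 0 hp; rewrite nth_iota; last by rewrite -[X in _ < X](size_iota 0) -has_find.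
rewrite add0n => /existsP [w' /andP [pw' /eqP lw']].
by exists w'; split => //; rewrite size_tuple.
Qed.

Lemma dist_lt_card u v : connect e u v -> dist e u v < #|T|.
Proof.
move=> /connectP [w0 pw0 ->]; case/shortenP: pw0 => w pw uw _.
apply: leq_ltn_trans (dist_le_size pw) _.
by have := max_card (mem (u :: w)); rewrite (card_uniqP uw).
Qed.

Lemma dist_refl u : dist e u u = 0.
Proof. by apply/eqP; rewrite -leqn0; apply: (@dist_le_size u [::]). Qed.

Hypotheses (e_sym : symmetric e) (e_irr : irreflexive e)
  (e_conn : forall u v, connect e u v).

Lemma dist_eq0 u v : dist e u v = 0 -> u = v.
Proof.
have [w [_ lw sw]] := dist_walk (e_conn u v) => d0.
by move: sw lw; rewrite d0; case: w.
Qed.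

Lemma dist_triangle u v w : dist e u w <= dist e u v + dist e v w.
Proof.
have [p [pp lp <-]] := dist_walk (e_conn u v).
have [q [pq lq <-]] := dist_walk (e_conn v w).
rewrite -size_cat -lq -lp -last_cat; apply: dist_le_size.
by rewrite cat_path pp lp.
Qed.

Lemma dist_edge u v : e u v -> dist e u v = 1.
Proof.
move=> euv; apply/eqP; rewrite eqn_leq (@dist_le_size u [:: v]) /= ?euv // lt0n.
by apply/eqP => /dist_eq0 euv'; rewrite euv' e_irr in euv.
Qed.

Lemma dist1_edge u v : dist e u v = 1 -> e u v.
Proof.
have [w [pw lw sw]] := dist_walk (e_conn u v) => d1.
move: sw pw lw; rewrite d1; case: w => [|a [|? ?]] //= _.
by rewrite andbT => h <-.
Qed.

Lemma dist_edgeE u v : (dist e u v == 1) = e u v.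
Proof. by apply/eqP/idP => [/dist1_edge | /dist_edge]. Qed.

Lemma dist_pred u w k : dist e u w = k.+1 -> exists2 v, e v w & dist e u v = k.
Proof.
have [p [pp lp sp]] := dist_walk (e_conn u w) => dk.
move: sp pp lp; rewrite dk; case/lastP: p => // p a.
rewrite size_rcons rcons_path last_rcons => -[sp] /andP [pp ea] ea'; subst a.
exists (last u p) => //; apply/eqP; rewrite eqn_leq -{1}sp dist_le_size //=.
have := dist_triangle u (last u p) w; rewrite dk (dist_edge ea).
by rewrite addn1 ltnS.
Qed.

Lemma dist_lip u v x : e u v -> dist e u x <= (dist e v x).+1.
Proof. by move=> /dist_edge euv; have := dist_triangle u v x; rewrite euv. Qed.

(** The list form of [dist_set] (see [dist_set_mind]), suited to paths that grow at the head. The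
    default [#|T|] exceeds all distances of a connected graph and acts as infinity. *)
Definition mind (R : seq T) (x : T) : nat :=
  foldr (fun v a => minn (dist e v x) a) #|T| R.

Lemma leq_mind k R x :
  (k <= mind R x) = (k <= #|T|) && all (fun v => k <= dist e v x) R.
Proof.
elim: R => [|v R IH] /=; first by rewrite andbT.
by rewrite leq_min IH andbCA.
Qed.

Lemma mind_le v R x : v \in R -> mind R x <= dist e v x.
Proof. by have := leqnn (mind R x); rewrite leq_mind => /andP [_ /allP h] /h. Qed.

Lemma mind_le_card R x : mind R x <= #|T|.
Proof. by have := leqnn (mind R x); rewrite leq_mind => /andP []. Qed.

Lemma mind_lt k R x : k <= #|T| -> mind R x < k -> exists2 v, v \in R & dist e v x < k.
Proof.
move=> hk; rewrite ltnNge leq_mind hk /= -has_predC => /hasP [v vR /= hv].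
by exists v; rewrite // ltnNge.
Qed.

Lemma eq_mind R R' x : R =i R' -> mind R x = mind R' x.
Proof.
move=> h; apply/eqP; rewrite eqn_leq.
by rewrite leq_mind -(eq_all_r h) -leq_mind leqnn leq_mind (eq_all_r h) -leq_mind leqnn.
Qed.

Lemma sub_mind (R R' : seq T) x : {subset R <= R'} -> mind R' x <= mind R x.
Proof.
move=> h; rewrite leq_mind; apply/andP; split.
  exact: mind_le_card.
by apply/allP => v /h; apply: mind_le.
Qed.

Lemma mind_lt_card v R x : v \in R -> mind R x < #|T|.
Proof. by move=> /mind_le h; apply: leq_ltn_trans (h x) (dist_lt_card (e_conn _ _)). Qed.

Lemma dist_set_mind R x : dist_set e x [set u in R] = mind R x.
Proof.
apply/eqP; rewrite eqn_leq; apply/andP; split.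
  rewrite leq_mind /dist_set; apply/andP; split.
    elim/big_ind: _ => [//|a b ha hb|v _]; first by rewrite geq_min ha.
    by apply: leq_trans (find_size _ _) _; rewrite size_iota.
  apply/allP => v vR; apply: bigmin_le; [exact: mem_index_enum | by rewrite inE].
rewrite /dist_set; elim/big_ind: _ => [|a b ha hb|v].
- exact: mind_le_card.
- by rewrite leq_min ha.
- by rewrite inE; apply: mind_le.
Qed.

Lemma ecc_mind R : ecc e [set u in R] = \max_x mind R x.
Proof. by apply: eq_bigr => x _; rewrite dist_set_mind. Qed.

End Distance.

Arguments mind {T} e R x.

(** * Shortest paths as lists read from the last vertex back to the source *)

Section Geodesics.

Variables (T : finType) (e : rel T).
Hypotheses (e_sym : symmetric e) (e_irr : irreflexive e)
  (e_conn : forall u v, connect e u v).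

(* Shortest paths from [s], listed backwards from their last vertex. *)
Inductive rpath (s : T) : seq T -> Prop :=
| rpath1 : rpath s [:: s]
| rpathS u w R : rpath s (u :: R) -> e u w -> dist e s w = (dist e s u).+1 ->
    rpath s [:: w, u & R].

Variable s : T.

Lemma rpath_inv u w R : rpath s [:: w, u & R] ->
  [/\ rpath s (u :: R), e u w & dist e s w = (dist e s u).+1].
Proof. by move=> H; inversion H. Qed.

Lemma rpath_inv1 w : rpath s [:: w] -> w = s.
Proof. by move=> H; inversion H. Qed.

Lemma rpath_dist w R : rpath s (w :: R) -> dist e s w = size R.
Proof.
elim: R w => [|u R IH] w; first by move/rpath_inv1=> ->; apply: dist_refl.
by case/rpath_inv => /IH h _ ->; rewrite h.
Qed.

Lemma rpath_nonempty R : rpath s R -> R != [::].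
Proof. by case. Qed.

Lemma rpath_src R : rpath s R -> s \in R.
Proof. by elim=> [|u w R' _ IH _ _]; rewrite inE ?eqxx // IH orbT. Qed.

Lemma rpath_catr c R : R != [::] -> rpath s (c ++ R) -> rpath s R.
Proof.
case: R => // u R _; elim: c => //= a [|b c] IH.
  by case/rpath_inv.
by case/rpath_inv => /IH.
Qed.

(** Each step is constrained only by an edge and two distances from [s], so what lies behind [u] can
    be replaced by any other shortest path from [s] to [u]. *)
Lemma rpath_swap c u R R' :
  rpath s (c ++ u :: R) -> rpath s (u :: R') -> rpath s (c ++ u :: R').
Proof.
elim: c => //= a [|b c] IH /rpath_inv [H ea da] H' /=; constructor => //.
exact: IH.
Qed.

Lemma rpath_nth R i : rpath s R -> i < size R -> dist e s (nth s R i) = (size R).-1 - i.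
Proof.
elim: R i => // w R IH [|i] H hi /=; first by rewrite (rpath_dist H) subn0.
case: R IH H hi => // u R IH /rpath_inv [H _ _] hi.
by rewrite IH.
Qed.

Lemma rpath_edge R i : rpath s R -> i.+1 < size R -> e (nth s R i.+1) (nth s R i).
Proof.
elim: R i => // w [|u R] IH [|i] // /rpath_inv [H ew _] hi //.
exact: IH.
Qed.

Lemma rpath_shortest R : rpath s R -> shortest_path e (rev R).
Proof.
move=> H; have R0 := rpath_nonempty H.
have hn i : i < size R -> dist e s (nth s (rev R) i) = i.
  move=> hi; rewrite nth_rev // rpath_nth //; lia.
have he i : i.+1 < size R -> e (nth s (rev R) i) (nth s (rev R) i.+1).
  move=> hi; rewrite !nth_rev //; last lia.
  have -> : size R - i.+1 = (size R - i.+2).+1 by lia.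
  by apply: rpath_edge => //; lia.
move: hn he; rewrite -size_rev; have: size (rev R) > 0 by rewrite size_rev; case: (R) R0.
case: (rev R) => [|v0 P] //= _ hn he.
have v0s : v0 = s by have := hn 0 isT => /(dist_eq0 e_conn).
subst v0; split => //; apply/(pathP s) => i hi; exact: (he i).
Qed.

Lemma shortest_rpath P : shortest_path e P -> exists s', rpath s' (rev P).
Proof.
case: P => // v0 P [pP hP]; exists v0; elim/last_ind: P pP hP => [|P w IH] pP hP.
  by constructor.
move: pP; rewrite rcons_path => /andP [pP ew].
have hP' i : i < size (v0 :: P) -> dist e v0 (nth v0 (v0 :: P) i) = i.
  move=> hi; have := hP i; rewrite -rcons_cons size_rcons nth_rcons hi; apply; lia.
have := IH pP hP'; rewrite -rcons_cons rev_rcons.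
have := hP (size P).+1; rewrite -rcons_cons size_rcons nth_rcons ltnn eqxx => /(_ (ltnSn _)) dw.
have := hP' (size P) (ltnSn _); rewrite nth_last /= => dl.
rewrite (lastI v0 P) rev_rcons => h; constructor => //.
by rewrite dw dl.
Qed.

End Geodesics.

(** * What the projection gap says about windows *)

Section Gap.

Variables (T : finType) (e : rel T) (g : nat).
Hypotheses (e_sym : symmetric e) (e_irr : irreflexive e)
  (e_conn : forall u v, connect e u v).
Hypothesis gap : proj_gap_le e g.

(* By the 1-Lipschitz property of the distance to [x], a window of [g + 1]
   vertices that is farther from [x] than both sides of the path produces two
   consecutive projections of [x], on a subpath, at distance at least [g + 2]. *)
Lemma gap_window s P x m a b :
  shortest_path e P -> head s P = s ->
  g < b - a -> b <= size P ->
  (forall j, a <= j < b -> m <= dist e (nth s P j) x) ->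
  forall i k, i < a -> b <= k < size P -> dist e (nth s P i) x < m ->
  m <= dist e (nth s P k) x.
Proof.
move=> spP hd hab hb hm i k ia kb fi; rewrite leqNgt; apply/negP => fk.
have [hpath hdist] : path e s (behead P) /\ forall j, j < size P -> dist e s (nth s P j) = j.
  by case: (P) spP hd => // v0 P' [] /= ? h ?; subst v0.
have Pe j : j.+1 < size P -> e (nth s P j) (nth s P j.+1).
  case: (P) hd hpath => // v0 P' /= -> /(pathP s) h hj; exact: h.
pose f j := dist e (nth s P j) x.
(* [i'] is the last vertex before the window, and [k'] the first one after it, that is closer to [x]
   than [m]; everything between them is at distance at least [m]. *)
have [i' [i'a fi' hi']] : exists i', [/\ i' < a, f i' < m & forall j, i' < j < a -> m <= f j].
  have ex : exists i, (i < a) && (f i < m) by exists i; rewrite ia.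
  have ub j : (j < a) && (f j < m) -> j <= a by case/andP => /ltnW.
  case: (ex_maxnP ex ub) => i' /andP [h1 h2] h3; exists i'; split => // j /andP [ij ja].
  by rewrite leqNgt; apply/negP => fj; have := h3 j; rewrite ja fj => /(_ isT); lia.
have [k' [k'b fk' hk']] : exists k', [/\ b <= k' < size P, f k' < m & forall j, b <= j < k' -> m <= f j].
  have ex : exists k, (b <= k < size P) && (f k < m) by exists k; rewrite kb.
  case: (ex_minnP ex) => k' /andP [h1 h2] h3; exists k'; split => // j /andP [ij ja].
  rewrite leqNgt; apply/negP => fj; have := h3 j; rewrite fj andbT.
  suff -> : b <= j < size P by move=> /(_ isT); lia.
  lia.
have hin j : i' < j < k' -> m <= f j.
  move=> hj; case: (ltnP j a) => ja; first by apply: hi'; lia.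
  by case: (ltnP j b) => jb; [apply: hm; lia | apply: hk'; lia].
have fi'e : (f i').+1 = m.
  apply/eqP; rewrite eqn_leq fi' /=; apply: leq_trans (hin i'.+1 _) _; first by lia.
  by apply: (dist_lip e_irr e_conn); rewrite e_sym; apply: Pe; lia.
have fk'e : (f k').+1 = m.
  apply/eqP; rewrite eqn_leq fk' /=; apply: leq_trans (hin k'.-1 _) _; first by lia.
  have ek : k' = k'.-1.+1 by lia.
  by rewrite {2}ek; apply: (dist_lip e_irr e_conn); apply: Pe; lia.
(* On the subpath [Q] from [i'] to [k'] the two ends are at distance [m - 1] from [x] and all other
   vertices are farther, so [x] projects exactly to the ends. They are at least [g + 2] apart, since
   at least [g + 1] window vertices lie between them. *)
pose Q := take (k' - i').+1 (drop i' P).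
have sQ : size Q = (k' - i').+1 by rewrite size_take size_drop; case: ifP => //; lia.
have nQ j y : j <= k' - i' -> nth y Q j = nth s P (i' + j).
  move=> hj; rewrite nth_take // nth_drop; apply: set_nth_default; lia.
have ltr : i' < k' by lia.
have dP j : j <= k' - i' -> dist e (nth s P i') (nth s P (i' + j)) = j.
  move=> hj; apply/eqP; rewrite eqn_leq; apply/andP; split; last first.
    have := dist_triangle e_conn s (nth s P i') (nth s P (i' + j)).
    by rewrite !hdist; lia.
  elim: j hj => [|j IH] hj; first by rewrite addn0 dist_refl.
  apply: leq_trans (dist_triangle e_conn _ (nth s P (i' + j)) _) _.
  have ej : e (nth s P (i' + j)) (nth s P (i' + j.+1)) by rewrite addnS; apply: Pe; lia.
  by rewrite (dist_edge e_irr e_conn ej) addn1 ltnS IH // ltnW.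
have spQ : shortest_path e Q.
  have : forall y, nth y Q 0 = nth s P i' by move=> y; rewrite nQ // addn0.
  move: sQ nQ; case: Q => // v0 Q' sQ nQ hv0; have /= v0e := hv0 s; subst v0; split.
    apply/(pathP s) => j hj.
    have := nQ j.+1 s; rewrite /= => ->; last by move: sQ hj => /=; lia.
    rewrite nQ; last by move: sQ hj => /=; lia.
    by rewrite addnS; apply: Pe; move: sQ hj => /=; lia.
  by move=> j hj; rewrite nQ ?dP //; move: sQ hj => /=; lia.
have dQ : dist_set e x [set u in Q] = f i'.
  rewrite dist_set_mind; apply/eqP; rewrite eqn_leq; apply/andP; split.
    apply: mind_le; have := nQ 0 s isT; rewrite addn0 => <-; apply: mem_nth; by rewrite sQ.
  rewrite leq_mind; apply/andP; split; first by apply: ltnW; apply: dist_lt_card.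
  apply/allP => v /(nthP s) [j]; rewrite sQ => hj; rewrite nQ // => <-.
  rewrite -/(f (i' + j)); case: (posnP j) => [->|j0]; first by rewrite addn0.
  case: (ltnP j (k' - i')) => jk; first by have := hin (i' + j); lia.
  have -> : i' + j = k' by lia.
  by rewrite -ltnS fi'e -fk'e.
have PrQ j : j <= k' - i' -> nth x Q j \in Pr e x [set u in Q] -> f (i' + j) = f i'.
  by move=> hj; rewrite !inE => /andP [_ /eqP]; rewrite dQ nQ.
have QPr j : j <= k' - i' -> f (i' + j) = f i' -> nth x Q j \in Pr e x [set u in Q].
  move=> hj hf; rewrite !inE mem_nth ?sQ //= dQ nQ //; exact/eqP.
have := gap spQ (x := x) (i := 0) (k := k' - i') _ _ _ _ _.
case; first by lia.
- by rewrite sQ.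
- by apply: QPr => //; rewrite addn0.
- apply: QPr => //; have -> : i' + (k' - i') = k' by lia. lia.
- rewrite !nQ // addn0 dP //; lia.
move=> j [j0 jk] /PrQ; rewrite ltnW // => /(_ isT) fj.
have := hin (i' + j); lia.
Qed.

(** The form used for backward lists: [take g.+1 R] is the window and [c] is what is appended after
    it. The strict inequality supplies a vertex behind the window that is closer to [x]. *)
Lemma rgap_window s c R x :
  rpath e s (c ++ R) -> mind e R x < mind e (take g.+1 R) x ->
  forall w, w \in c -> mind e (take g.+1 R) x <= dist e w x.
Proof.
move=> H hlt w wc.
set m := mind e (take g.+1 R) x in hlt *.
have R0 : R != [::] by case: (R) @m hlt => //=; rewrite ltnn.
have hm : m <= #|T| := mind_le_card _ _ _.
have [v vR dv] := mind_lt hm hlt.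
(* If [R] fitted into the window, the two minima would agree; hence the window consists of [g + 1]
   vertices and something lies behind it. *)
have sR : g.+1 < size R.
  rewrite ltnNge; apply/negP => hs; have : m <= dist e v x by apply: mind_le; rewrite take_oversize.
  by rewrite leqNgt dv.
pose P := rev (c ++ R).
have sP : size P = size c + size R by rewrite size_rev size_cat.
have hd : head s P = s.
  have := rpath_nth H (i := (size (c ++ R)).-1).
  have sz : 0 < size (c ++ R) by rewrite size_cat; lia.
  rewrite prednK // leqnn subnn => /(_ isT) /(dist_eq0 e_conn) es.
  by rewrite -nth0 nth_rev // subn1 -es.
have nP j : j < size (c ++ R) -> nth s P ((size (c ++ R)).-1 - j) = nth s (c ++ R) j.
  by move=> hj; rewrite nth_rev; [congr nth|]; lia.
have /(nthP s) [iv hiv ev] : v \in R := vR.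
have /(nthP s) [iw hiw ew] : w \in c := wc.
have iv_big : g < iv.
  rewrite ltnNge; apply/negP => hs; have : m <= dist e v x.
    by apply: mind_le; rewrite -ev -(@nth_take g.+1) // mem_nth // size_take; case: ifP; lia.
  by rewrite leqNgt dv.
have {}hiv : iv < size R := hiv.
have {}hiw : iw < size c := hiw.
have := @gap_window s P x m (size R - g.+1) (size R) (rpath_shortest e_conn H) hd.
have sC : size (c ++ R) = size c + size R by rewrite size_cat.
move=> /(_ _ _ _ ((size (c ++ R)).-1 - (size c + iv)) ((size (c ++ R)).-1 - iw)).
have nR j : nth s (c ++ R) (size c + j) = nth s R j.
  by rewrite nth_cat ltnNge leq_addr /= addKn.
rewrite !nP ?nR ?ev ?nth_cat ?hiw ?ew ?sC; try lia.
apply => //; rewrite ?sP; try lia.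
move=> j hj.
(* Position [j] of [P] counts from the source; the same vertex has index [size R - j.+1] in [R], and
   this is below [g.+1] exactly on the window. *)
have -> : j = (size (c ++ R)).-1 - (size c + (size R - j.+1)) by rewrite sC; lia.
rewrite nP ?nR ?sC; last lia.
apply: mind_le.
have hj' : size R - j.+1 < g.+1 by lia.
by rewrite -(@nth_take g.+1) // mem_nth // size_take sR.
Qed.

End Gap.

(** * Windows and the value of a path *)

Section Windows.

Variables (n' g : nat).
Local Notation n := n'.+1.
Local Notation T := 'I_n.

(* A window of [g + 1] vertices is a number with [g + 1] digits in base [n], the
   most recent vertex being the leading digit; [step] shifts a vertex in. *)
Definition step (q w : nat) : nat := w * n ^ g + q %/ n.
Definition top (q : nat) : T := inord (q %/ n ^ g).
Definition digits (q : nat) : seq T := [seq inord (q %/ n ^ i %% n) | i <- iota 0 g.+1].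

Definition start (s : nat) : nat := iter g.+1 (fun q => step q s) 0.

(* Windows of paths with fewer than [g + 1] vertices are padded with the source. *)
Definition code (s : T) (R : seq T) : nat :=
  foldr (fun (w : T) q => step q w) (iter g (fun q => step q s) 0) R.

Lemma step_lt q w : w < n -> q < n ^ g.+1 -> step q w < n ^ g.+1.
Proof.
move=> hw hq; rewrite /step expnS.
have : q %/ n < n ^ g by rewrite ltn_divLR // -expnSr.
have : w * n ^ g <= n' * n ^ g by rewrite leq_mul2r -ltnS hw orbT.
rewrite mulSn; lia.
Qed.

Lemma start_iter_lt k s : s < n -> iter k (fun q => step q s) 0 < n ^ g.+1.
Proof.
by move=> hs; elim: k => [|k IH] /=; rewrite ?expn_gt0 // step_lt.
Qed.

Lemma code_lt s R : code s R < n ^ g.+1.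
Proof.
by elim: R => [|w R IH] /=; rewrite ?start_iter_lt ?step_lt.
Qed.

Lemma code1 s : code s [:: s] = start s.
Proof. by []. Qed.

(** Counted from the leading digit, so that index [j] agrees with position [j] of a backward
    path. *)
Definition digit (q j : nat) : nat := q %/ n ^ (g - j) %% n.

Lemma digit_step0 q w : w < n -> q < n ^ g.+1 -> digit (step q w) 0 = w.
Proof.
move=> hw hq; rewrite /digit subn0 /step divnMDl ?expn_gt0 //.
by rewrite (@divn_small (q %/ n)) ?addn0 ?modn_small // ltn_divLR // -expnSr.
Qed.

Lemma digit_stepS q w j : j < g -> digit (step q w) j.+1 = digit q j.
Proof.
move=> hj; rewrite /digit /step.
have -> : n ^ g = n ^ j * n * n ^ (g - j.+1) by rewrite -expnSr -expnD; congr expn; lia.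
rewrite mulnA divnMDl ?expn_gt0 // mulnA modnMDl -divnMA -expnS.
by congr (_ %/ n ^ _ %% _); lia.
Qed.

Lemma digit_iter k s j : s < n -> j <= g -> j < k ->
  digit (iter k (fun q => step q s) 0) j = s.
Proof.
move=> hs; elim: k j => // k IH [|j] hj hk /=.
  by rewrite digit_step0 // start_iter_lt.
by rewrite digit_stepS // IH // ltnW.
Qed.

(** Padding needs no separate case: beyond the end of [R] the code carries the source, which is also
    the default of [nth]. The code consists of [g] pads followed by the vertices of [R]. *)
Lemma digit_code s R j : j <= g -> j < size R + g -> digit (code s R) j = nth s R j.
Proof.
elim: R j => [|w R IH] j hj hs; first by rewrite nth_nil digit_iter.
case: j hj hs => [|j] hj hs /=; first by rewrite digit_step0 // code_lt.
by rewrite digit_stepS // IH //; move: hs => /=; lia.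
Qed.

(** Only the sets agree, not the lists: the padding repeats [s], which does no harm because a short
    [R] lies inside the window together with [s]. *)
Lemma digits_code s (R : seq T) : s \in R -> digits (code s R) =i take g.+1 R.
Proof.
move=> sR v; have R0 : 0 < size R by case: (R) sR.
have dE i : i <= g -> inord (code s R %/ n ^ i %% n) = nth s R (g - i).
  move=> hi; rewrite -[X in _ = X]inord_val -digit_code ?leq_subr //; last lia.
  by rewrite /digit subKn.
have sT (w : T) : w \in take g.+1 R -> exists2 j, j <= g & w = nth s R j /\ j < size R.
  move=> /(nthP s) [j]; rewrite size_take_min leq_min => /andP [h1 h2] <-.
  by exists j => //; rewrite nth_take.
apply/idP/idP => [/mapP [i]|/sT [j hj [-> js]]].
  rewrite mem_iota add0n /= => hi ->; rewrite dE //.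
  case: (ltnP (g - i) (size R)) => h.
    by rewrite -(@nth_take g.+1) ?ltnS ?leq_subr // mem_nth // size_take_min leq_min ltnS leq_subr h.
  rewrite nth_default // take_oversize //; lia.
apply/mapP; exists (g - j); first by rewrite mem_iota; lia.
by rewrite dE ?leq_subr // subKn.
Qed.

Lemma top_step q (w : T) : q < n ^ g.+1 -> top (step q w) = w.
Proof.
move=> hq; rewrite /top -[RHS]inord_val; congr inord.
have := digit_step0 (ltn_ord w) hq; rewrite /digit subn0 modn_small //.
by rewrite ltn_divLR ?expn_gt0 // -expnS step_lt.
Qed.

Lemma top_code s w R : top (code s (w :: R)) = w.
Proof. by rewrite /= top_step // code_lt. Qed.

End Windows.

Arguments digits n' g q : clear implicits.
Arguments step n' g q w : clear implicits.
Arguments code n' g s R : clear implicits.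
Arguments top n' g q : clear implicits.
Arguments start n' g s : clear implicits.

(** * The eccentricity of a path as a maximum over its window shifts *)

Section PathValue.

Variables (n' g : nat) (e : rel 'I_n'.+1).
Local Notation n := n'.+1.
Local Notation T := 'I_n.
Local Notation step := (step n' g).
Local Notation code := (code n' g).

Definition wdist (q : nat) (x : T) : nat := mind e (digits n' g q) x.

Section Value.

(* [M q x] is the least distance from [x] to a shortest path from the source with
   window [q].  When it is smaller than [wdist q x], no continuation beyond the
   window gets closer to [x] than the window itself: [x] is decided at [q]. *)
Variable M : nat -> T -> nat.

Definition decided q x := M q x < wdist q x.

Definition charge (q : nat) (w : T) : nat :=
  \max_(x | decided (step q w) x && ~~ decided q x) minn (wdist q x) (dist e w x).

Definition rest (q : nat) : nat := \max_(x | ~~ decided q x) wdist q x.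

Fixpoint pcost (s : T) (R : seq T) : nat :=
  if R is w :: R' then
    if R' is [::] then 0 else maxn (pcost s R') (charge (code s R') w)
  else 0.

End Value.

Hypotheses (e_sym : symmetric e) (e_irr : irreflexive e)
  (e_conn : forall u v, connect e u v).
Hypothesis gap : proj_gap_le e g.
Variables (s : T) (M : nat -> T -> nat).
(** With [M_attained] this makes [M q x] the minimum over the paths with window [q]. It is kept
    abstract because [M] will be the contents of a table after the first pass. *)
Hypothesis M_le : forall R x, rpath e s R -> M (code s R) x <= mind e R x.
Hypothesis M_attained : forall R x, rpath e s R ->
  exists R', [/\ rpath e s R', code s R' = code s R & mind e R' x <= M (code s R) x].

Lemma wdist_code R x : rpath e s R -> wdist (code s R) x = mind e (take g.+1 R) x.
Proof. by move=> /rpath_src sR; apply: eq_mind; apply: digits_code. Qed.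

Lemma mind_le_wdist R x : rpath e s R -> mind e R x <= wdist (code s R) x.
Proof.
by move=> H; rewrite wdist_code //; apply: sub_mind => v; apply: mem_take.
Qed.

(** The path [R] itself need not come closer to [x] than its window; the witness [R'] does. As [R']
    ends in the same vertex, [w] can be appended to it too, and [rgap_window] applies to that
    path. *)
Lemma decided_next R x w : rpath e s (w :: R) -> R != [::] ->
  decided M (code s R) x -> wdist (code s R) x <= dist e w x.
Proof.
move=> H R0 dx; have HR := rpath_catr (c := [:: w]) R0 H.
have [R' [H' cR' hM]] := M_attained x HR.
have hlt : mind e R' x < wdist (code s R) x := leq_ltn_trans hM dx.
rewrite -cR' (wdist_code x H') in hlt *.
suff Hw : rpath e s ([:: w] ++ R') by apply: (rgap_window e_sym e_irr e_conn gap Hw hlt); rewrite inE.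
case: R' H' cR' {hM hlt} => [|u' R'] H' cR'; first by inversion H'.
case: R R0 H HR cR' {dx} => // u R _ H HR cR'.
have eu : u' = u by have := top_code g s u R; rewrite -cR' top_code.
subst u'; exact: (rpath_swap (c := [:: w]) H H').
Qed.

(** Undecided means [wdist <= M], which closes the chain [M <= mind <= wdist]. *)
Lemma undecided_mind R x : rpath e s R -> ~~ decided M (code s R) x ->
  mind e R x = wdist (code s R) x.
Proof.
move=> H; rewrite /decided -leqNgt => h; apply/eqP.
by rewrite eqn_leq mind_le_wdist // (leq_trans h) // M_le.
Qed.

(** The witness extended by [w] still has its vertex close to [x]. The new window could only come as
    close through [w], since its other vertices belong to the old window, and [decided_next]
    excludes [w]. *)
Lemma decided_mono R x w : rpath e s (w :: R) -> R != [::] ->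
  decided M (code s R) x -> decided M (code s (w :: R)) x.
Proof.
move=> H R0 dx; have HR := rpath_catr (c := [:: w]) R0 H.
have dw := decided_next H R0 dx.
have [R' [H' cR' hM]] := M_attained x HR.
have Hw : rpath e s (w :: R').
  case: R' H' cR' {hM} => [|u' R'] H' cR'; first by inversion H'.
  case: R R0 H HR cR' {dx dw} => // u R _ H HR cR'.
  have eu : u' = u by have := top_code g s u R; rewrite -cR' top_code.
  subst u'; exact: (rpath_swap (c := [:: w]) H H').
have cw : code s (w :: R') = code s (w :: R) by rewrite /= -!/(code s _) cR'.
rewrite /decided -cw; apply: leq_ltn_trans (M_le x Hw) _.
apply: (@leq_ltn_trans (mind e R' x)); first by rewrite /= geq_minr.
apply: leq_trans (leq_ltn_trans hM dx) _.
rewrite (wdist_code x Hw) /= leq_min dw -cR' (wdist_code x H') /=.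
have -> : take g R' = take g (take g.+1 R') by rewrite -take_min (minn_idPl _).
by apply: sub_mind => v; apply: mem_take.
Qed.

(** By [decided_mono] the vertices decided after a shift are those decided before, which [w] does
    not affect by [decided_next], and the new ones, whose distance to the path before the shift is
    [wdist] by [undecided_mind]. *)
Lemma pcostE R : rpath e s R ->
  pcost M s R = \max_(x | decided M (code s R) x) mind e R x.
Proof.
elim: R => [|w R IH] H; first by inversion H.
case: (R =P [::]) => [R0|/eqP R0].
  subst R; have ws := rpath_inv1 H; subst w.
  (* Nothing is decided at the start window: a shortest path from [s] with this window ends in [s],
     so it is [[:: s]] and comes no closer than its window. *)
  rewrite big_pred0 // => x; apply/negP => dx.
  have [R' [H' cR' hM]] := M_attained x H.
  have := leq_ltn_trans hM dx; rewrite wdist_code //.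
  case: R' H' cR' {hM} => [|u' R'] H' cR'; first by inversion H'.
  have eu : u' = s by have := top_code g s s [::]; rewrite -cR' top_code.
  subst u'; have := rpath_dist H'; rewrite dist_refl => /esym /size0nil ->.
  by rewrite ltnn.
have HR := rpath_catr (c := [:: w]) R0 H.
have -> : pcost M s (w :: R) = maxn (pcost M s R) (charge M (code s R) w).
  by case: (R) R0.
rewrite (IH HR) /charge -/(code s (w :: R)).
rewrite [RHS](bigID (decided M (code s R))) /=; congr maxn.
  apply: eq_big => [x|x dx].
    apply/idP/andP => [dx|[] //]; split => //; exact: decided_mono.
  rewrite /= ; apply/esym/minn_idPr.
  exact: leq_trans (mind_le_wdist x HR) (decided_next H R0 dx).
apply: eq_bigr => x /andP [_ dx].
by rewrite (undecided_mind HR dx) minnC.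
Qed.

Lemma ecc_value R : rpath e s R ->
  ecc e [set u in R] = maxn (pcost M s R) (rest M (code s R)).
Proof.
move=> H; rewrite ecc_mind (pcostE H) (bigID (decided M (code s R))) /=; congr maxn.
by apply: eq_bigr => x dx; apply: undecided_mind.
Qed.

Lemma pcost_lt R : rpath e s R -> pcost M s R < n.
Proof.
move=> H; rewrite pcostE //; apply: ltn_bigmax => // x _.
by have := mind_lt_card e_conn x (rpath_src H); rewrite card_ord.
Qed.

Section Optimum.

Variables (D par : nat -> nat).

Definition trans q (w : T) :=
  e (top n' g q) w && (dist e s w == (dist e s (top n' g q)).+1).

Hypothesis D_start : D (start n' g s) = 0.
Hypothesis D_le : forall q w, q < n ^ g.+1 -> D q < n -> trans q w ->
  D (step q w) <= maxn (D q) (charge M q w).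
Hypothesis D_par : forall q, q < n ^ g.+1 -> D q < n -> q <> start n' g s ->
  exists w, [/\ par q < n ^ g.+1, D (par q) < n, trans (par q) w,
    q = step (par q) w & maxn (D (par q)) (charge M (par q) w) <= D q].

Lemma D_le_pcost R : rpath e s R -> D (code s R) <= pcost M s R.
Proof.
elim: R => [|w R IH] H; first by inversion H.
case: R IH H => [|u R] IH H.
  by have ws := rpath_inv1 H; subst w; rewrite code1 D_start.
have [HR eu du] := rpath_inv H.
rewrite /= -/(code s (u :: R)); have hD := IH HR.
apply: leq_trans (D_le (code_lt _ _ _) (leq_ltn_trans hD (pcost_lt HR)) _) _.
  by rewrite /trans top_code eu du eqxx.
by rewrite geq_max leq_max hD leq_maxr.
Qed.

(** Going to [par q] lowers the distance of the leading vertex from [s] by one, which gives the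
    induction. The last clause is what allows the path to be read off by following [par]. *)
Lemma D_attained q : q < n ^ g.+1 -> D q < n ->
  exists R, [/\ rpath e s R, code s R = q, pcost M s R <= D q &
    forall i, i < size R -> iter i par q = code s (drop i R)].
Proof.
have [k hk] := ubnP (dist e s (top n' g q)); elim: k q hk => // k IH q hk qN Dq.
case: (q =P start n' g s) => [->|qs].
  exists [:: s]; split => //; first by constructor.
  by case.
have [w [pN Dp /andP [eu /eqP dw] qE hD]] := D_par qN Dq qs.
have tq : top n' g q = w by rewrite qE top_step.
rewrite tq dw ltnS in hk; have [R [HR cR hc hi]] := IH (par q) hk pN Dp.
have HR0 := rpath_nonempty HR.
exists (w :: R); split.
- case: R HR cR HR0 {hc hi} => // u R HR cR _.
  have tu : top n' g (par q) = u by rewrite -cR top_code.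
  by constructor => //; rewrite -tu.
- by rewrite /= -/(code s R) cR -qE.
- have -> : pcost M s (w :: R) = maxn (pcost M s R) (charge M (code s R) w).
    by case: (R) HR0.
  by apply: leq_trans hD; rewrite cR geq_max leq_max hc leq_maxr.
- case=> [|i] hi'; first by rewrite drop0 /= -/(code s R) cR -qE.
  by rewrite iterSr hi.
Qed.

End Optimum.
End PathValue.

(** * Weakest preconditions with time *)

(** Total correctness in the form the theorem requires: a halting execution is exhibited together
    with its time. *)
Definition wp (A : prog) (s : state) (Q : state -> nat -> Prop) : Prop :=
  exists s' t, exec A s s' t /\ Q s' t.

Lemma wp_mono A s (Q Q' : state -> nat -> Prop) :
  wp A s Q -> (forall s' t, Q s' t -> Q' s' t) -> wp A s Q'.
Proof. by case=> s' [t [? ?]] H; exists s', t; split => //; apply: H. Qed.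

Lemma wp_skip s (Q : state -> nat -> Prop) : Q s 1 -> wp Skip s Q.
Proof. by move=> H; exists s, 1; split => //; constructor. Qed.

Lemma wp_assign r a s (Q : state -> nat -> Prop) :
  Q (State (update (regs s) r (eval s a)) (memory s)) (cost a).+1 ->
  wp (Assign r a) s Q.
Proof. by move=> H; eexists _, _; split; [constructor | exact: H]. Qed.

Lemma wp_store a b s (Q : state -> nat -> Prop) :
  Q (State (regs s) (update (memory s) (eval s a) (eval s b))) (cost a + cost b).+1 ->
  wp (Store a b) s Q.
Proof. by move=> H; eexists _, _; split; [constructor | exact: H]. Qed.

Lemma wp_seq A A' s (Q : state -> nat -> Prop) :
  wp A s (fun s' t => wp A' s' (fun s'' t' => Q s'' (t + t'))) -> wp (Seq A A') s Q.
Proof.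
case=> s' [t [H1 [s'' [t' [H2 H3]]]]].
by exists s'', (t + t'); split => //; apply: exec_seq H1 H2.
Qed.

Lemma wp_if a b A A' s (Q : state -> nat -> Prop) :
  (eval s a < eval s b -> wp A s (fun s' t => Q s' ((cost a + cost b).+1 + t))) ->
  (eval s b <= eval s a -> wp A' s (fun s' t => Q s' ((cost a + cost b).+1 + t))) ->
  wp (If a b A A') s Q.
Proof.
case: (ltnP (eval s a) (eval s b)) => h H1 H2.
  have [s' [t [H3 H4]]] := H1 isT.
  by eexists s', _; split; [apply: exec_if_true H3 | exact: H4].
have [s' [t [H3 H4]]] := H2 isT.
by eexists s', _; split; [apply: exec_if_false H3 | exact: H4].
Qed.

Definition agree (k : nat) (s s' : state) : Prop := forall r, r < k -> regs s' r = regs s r.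

Lemma agreeW k k' s s' : k' <= k -> agree k s s' -> agree k' s s'.
Proof. by move=> hk h r hr; apply: h; apply: leq_trans hk. Qed.

(* A loop with counter [k] leaves the registers below [k] unchanged; its
   invariant may depend on the memory and on the registers [k + 1], [k + 2]. *)
Definition For (k b : nat) (body : prog) : prog :=
  Seq (Assign k (Const 0))
      (While (Reg k) (Reg b) (Seq body (Assign k (Add (Reg k) (Const 1))))).

Lemma updateE f a v b : update f a v b = if b == a then v else f b.
Proof. by []. Qed.

Lemma update_neq f a v b : b != a -> update f a v b = f b.
Proof. by rewrite updateE => /negbTE ->. Qed.

(** The bound [tb i] may vary with the round, so that loops over neighbours add up to a sum of
    degrees. Each round adds 3 for the test and 4 for the increment; the final 5 is 2 for clearing
    the counter and 3 for the failing test. *)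
Lemma wp_for k b body (I : nat -> nat -> nat -> (nat -> nat) -> Prop) tb s :
  b < k ->
  I 0 (regs s k.+1) (regs s k.+2) (memory s) ->
  (forall i s', i < regs s b -> agree k s s' -> regs s' k = i ->
    I i (regs s' k.+1) (regs s' k.+2) (memory s') ->
    wp body s' (fun s'' t => [/\ t <= tb i, agree k.+1 s' s'' &
      I i.+1 (regs s'' k.+1) (regs s'' k.+2) (memory s'')])) ->
  wp (For k b body) s (fun s' t =>
    [/\ t <= \sum_(0 <= i < regs s b) (tb i + 7) + 5, agree k s s' &
      I (regs s b) (regs s' k.+1) (regs s' k.+2) (memory s')]).
Proof.
move=> bk I0 Hb; set N := regs s b.
have loop d s0 : d <= N -> agree k s s0 -> regs s0 k = N - d ->
    I (N - d) (regs s0 k.+1) (regs s0 k.+2) (memory s0) ->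
    wp (While (Reg k) (Reg b) (Seq body (Assign k (Add (Reg k) (Const 1))))) s0
      (fun s' t => [/\ t <= \sum_(N - d <= i < N) (tb i + 7) + 3, agree k s s' &
        I N (regs s' k.+1) (regs s' k.+2) (memory s')]).
  elim: d s0 => [|d IH] s0 hd ag rk Ik.
    exists s0, 3; split; last by split => //; [lia | rewrite subn0 in Ik].
    by apply: (@exec_while_false (Reg k) (Reg b) _ s0); rewrite /= rk ag // subn0.
  have hlt : N - d.+1 < N by lia.
  have [s1 [t1 [E1 [ht1 ag1 I1]]]] := Hb _ _ hlt ag rk Ik.
  have eS : (N - d.+1).+1 = N - d by lia.
  rewrite eS in I1.
  pose s2 := State (update (regs s1) k (regs s1 k + 1)) (memory s1).
  have [] := IH s2 (ltnW hd).
  - by move=> r hr; rewrite /= update_neq ?ag1 ?ag // ?ltnS 1?ltnW // neq_ltn hr.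
  - by rewrite /= updateE eqxx ag1 // rk addn1.
  - by rewrite /s2 /= !update_neq ?neq_ltn //; lia.
  move=> s3 [t3 [E3 [ht3 ag3 I3]]].
  exists s3, ((cost (Reg k) + cost (Reg b)).+1 + (t1 + 4) + t3); split.
    apply: exec_while_true E3; first by rewrite /= rk ag.
    by apply: exec_seq E1 _; apply: (@exec_assign _ k (Add (Reg k) (Const 1))).
  by split => //=; rewrite big_ltn // eS; lia.
apply: wp_seq; apply: wp_assign; rewrite [eval _ _]/= [cost _]/=.
have := loop N (State (update (regs s) k 0) (memory s)) (leqnn _); rewrite subnn => H.
apply: (wp_mono (H _ _ _)) => /=.
- by move=> r hr; rewrite /= update_neq // neq_ltn hr.
- by rewrite updateE eqxx.
- by rewrite !update_neq // neq_ltn; lia.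
- by move=> s' t [ht ag Is]; split => //; lia.
Qed.

Lemma wp_for_const k b body (I : nat -> nat -> nat -> (nat -> nat) -> Prop) tb s :
  b < k ->
  I 0 (regs s k.+1) (regs s k.+2) (memory s) ->
  (forall i s', i < regs s b -> agree k s s' -> regs s' k = i ->
    I i (regs s' k.+1) (regs s' k.+2) (memory s') ->
    wp body s' (fun s'' t => [/\ t <= tb, agree k.+1 s' s'' &
      I i.+1 (regs s'' k.+1) (regs s'' k.+2) (memory s'')])) ->
  wp (For k b body) s (fun s' t =>
    [/\ t <= regs s b * (tb + 7) + 5, agree k s s' &
      I (regs s b) (regs s' k.+1) (regs s' k.+2) (memory s')]).
Proof.
move=> bk I0 Hb; apply: (wp_mono (wp_for (tb := fun=> tb) bk I0 Hb)) => s' t [ht ag Is].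
by split => //; move: ht; rewrite sum_nat_const_nat subn0.
Qed.

(** Multiplication by the number of tables, spelled out as a sum. It copies its argument nine times,
    so every nested table access multiplies the cost by nine; this is the origin of the constants in
    the hundreds below. *)
Definition times9 (a : expr) : expr :=
  Add (Add (Add (Add a a) (Add a a)) (Add (Add a a) (Add a a))) a.
Definition addr (j : nat) (a : expr) : expr := Add (Reg 0) (Add (Const j) (times9 a)).
Definition Get (j : nat) (a : expr) : expr := Defs.Mem (addr j a).
Definition Put (j : nat) (a b : expr) : prog := Store (addr j a) b.

(* Nine infinite tables, interleaved above the address [B]: for numbers [k],
   windows [q] and vertices [u], [x],
   0: [k * n];  1: [q %/ n];  2: leading digit of [q];  3: [k * n ^ g];
   4: distance of [u] and [x], at [u * n + x];
   5: distance of [x] to the window [q], at [q * n + x];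
   6: least distance of [x] to a path with window [q], at [q * n + x];
   7: least cost of a path with window [q];  8: its previous window.
   In tables 4, 6 and 7, [n] stands for infinity. *)
Definition tab (B : nat) (m : nat -> nat) (j i : nat) : nat := m (B + (j + 9 * i)).
Definition tput (B : nat) (m : nat -> nat) (j i v : nat) : nat -> nat :=
  update m (B + (j + 9 * i)) v.

Lemma eval_get j a s : eval s (Get j a) = tab (regs s 0) (memory s) j (eval s a).
Proof. by rewrite /= /tab; congr (memory s (_ + (_ + _))); lia. Qed.

Lemma cost_get j a : cost (Get j a) = 9 * cost a + 13.
Proof. by rewrite /=; lia. Qed.

Lemma wp_put j a b s (Q : state -> nat -> Prop) :
  Q (State (regs s) (tput (regs s 0) (memory s) j (eval s a) (eval s b)))
    (9 * cost a + 13 + cost b) ->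
  wp (Put j a b) s Q.
Proof.
move=> H; apply: wp_store.
have -> : (cost (addr j a) + cost b).+1 = 9 * cost a + 13 + cost b by rewrite /=; lia.
have -> : eval s (addr j a) = regs s 0 + (j + 9 * eval s a) by rewrite /=; lia.
exact: H.
Qed.

Global Opaque Get.

Lemma tab_put B m j i v j' i' : j < 9 -> j' < 9 ->
  tab B (tput B m j i v) j' i' = if (j' == j) && (i' == i) then v else tab B m j' i'.
Proof.
move=> hj hj'; rewrite /tab /tput updateE eqn_add2l.
suff -> : (j' + 9 * i' == j + 9 * i) = (j' == j) && (i' == i) by [].
apply/eqP/andP => [h|[/eqP -> /eqP -> //]].
have ei : i' = i by lia.
by subst i'; move: h => /addIn ->.
Qed.

Lemma low_put B m j i v a : a < B -> tput B m j i v a = m a.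
Proof. by move=> ha; rewrite /tput update_neq // neq_ltn; apply/orP; left; lia. Qed.

Definition frame (B : nat) (js : seq nat) (m m' : nat -> nat) : Prop :=
  (forall a, a < B -> m' a = m a) /\
  (forall j i, j < 9 -> j \notin js -> tab B m' j i = tab B m j i).

Lemma frame_trans B js m m' m'' : frame B js m m' -> frame B js m' m'' -> frame B js m m''.
Proof.
move=> [h1 h2] [h3 h4]; split => [a ha|j i hj hjs]; first by rewrite h3 ?h1.
by rewrite h4 ?h2.
Qed.

Lemma frame_put B js m j i v : j < 9 -> j \in js -> frame B js m (tput B m j i v).
Proof.
move=> hj hjs; split=> [a|j' i' hj' hjs']; first exact: low_put.
rewrite tab_put //; case: eqP => //= ej; by rewrite ej hjs in hjs'.
Qed.

Lemma frameW B (js js' : seq nat) m m' :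
  all (fun j => j \in js') js -> frame B js m m' -> frame B js' m m'.
Proof.
move=> /allP h [h1 h2]; split => // j i hj hjs; apply: h2 => //.
by apply: contra hjs; apply: h.
Qed.

Ltac wps := repeat match goal with
  | |- wp (Seq _ _) _ _ => apply: wp_seq
  | |- wp (Assign _ _) _ _ => apply: wp_assign
  | |- wp (Put _ _ _) _ _ => apply: wp_put
  | |- wp (Store _ _) _ _ => apply: wp_store
  | |- wp Skip _ _ => apply: wp_skip
  end.

Ltac sim := do 4 rewrite /= ?(eval_get, cost_get); rewrite /= ?updateE /=.
Ltac upd := rewrite /= /update;
  repeat (case: eqP => [?|_]; [by exfalso; lia|]); try done.
Ltac agr := let r := fresh "r" in let hr := fresh "hr" in move=> r hr; upd.

(** * Distance tables *)

(** Register 0 receives the address where the last adjacency list ends, so the tables start right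
    behind the input. Registers 3 and 4 receive [n ^ g] and [n ^ g.+1] by repeated addition;
    register 2 counts [g] rounds before it becomes [g + 1]. *)
Definition setup : prog :=
  Seq (Assign 1 (Defs.Mem (Const 0)))
 (Seq (Assign 2 (Defs.Mem (Const 2)))
 (Seq (Assign 0 (Defs.Mem (Add (Const 3) (Reg 1))))
 (Seq (Assign 6 (Const 1))
 (Seq (For 5 2 (Seq (Assign 8 (Const 0))
               (Seq (For 7 1 (Assign 8 (Add (Reg 8) (Reg 6))))
                    (Assign 6 (Reg 8)))))
 (Seq (Assign 3 (Reg 6))
 (Seq (Assign 6 (Const 0))
 (Seq (For 5 1 (Assign 6 (Add (Reg 6) (Reg 3))))
 (Seq (Assign 4 (Reg 6))
      (Assign 2 (Add (Reg 2) (Const 1))))))))))).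

Definition fill_mul : prog :=
  Seq (Assign 6 (Const 0))
      (For 5 4 (Seq (Put 0 (Reg 5) (Reg 6)) (Assign 6 (Add (Reg 6) (Reg 1))))).

(** Division by enumeration: the quotient [k] is written at all [n] dividends [k * n + r].
    [fill_top] treats division by [n ^ g] in the same way. *)
Definition fill_div : prog :=
  For 5 3 (For 6 1 (Put 1 (Add (Get 0 (Reg 5)) (Reg 6)) (Reg 5))).

Definition fill_top : prog :=
  Seq (Assign 6 (Const 0))
      (For 5 1 (Seq (Put 3 (Reg 5) (Reg 6))
               (Seq (For 7 3 (Put 2 (Add (Reg 6) (Reg 7)) (Reg 5)))
                    (Assign 6 (Add (Reg 6) (Reg 3)))))).

Section Tables.

Variables (n' g B : nat).
Local Notation n := n'.+1.
Local Notation tab := (tab B).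
Local Notation frame := (frame B).

Definition globals (s : state) : Prop :=
  [/\ regs s 0 = B, regs s 1 = n, regs s 2 = g.+1, regs s 3 = n ^ g &
      regs s 4 = n ^ g.+1].

Lemma globals_agree k s s' : 5 <= k -> agree k s s' -> globals s -> globals s'.
Proof.
move=> hk h [h0 h1 h2 h3 h4]; split; rewrite h //; lia.
Qed.

Lemma globals_upd k v s m :
  5 <= k -> globals s -> globals (State (update (regs s) k v) m).
Proof.
move=> hk [h0 h1 h2 h3 h4]; split; rewrite /= update_neq // neq_ltn; lia.
Qed.

Lemma setup_spec s :
  memory s 0 = n -> memory s 2 = g -> memory s (3 + n) = B ->
  wp setup s (fun s' t =>
    [/\ t <= g * (n * 12 + 20) + n * 12 + 60, globals s' & memory s' = memory s]).
Proof.
move=> m0 m2 mB; rewrite /setup; wps; sim; rewrite m0 m2 mB.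
pose I1 (i a b : nat) (m : nat -> nat) := a = n ^ i /\ m = memory s.
apply: (wp_mono (wp_for_const (I := I1) (tb := n * 12 + 13) _ _ _)) => //.
  move=> i s1; sim => hi ag1 _ [a1 hm]; wps; sim.
  pose I2 (i' a b : nat) (m : nat -> nat) := a = i' * n ^ i /\ m = memory s.
  apply: (wp_mono (wp_for_const (I := I2) (tb := 5) _ _ _)) => //.
    move=> j s2; sim => hj ag2 _ [a2 hm2]; wps; sim; split => //; first by agr.
    by split => //; rewrite a2 ag2 //= /update /= a1 mulSn addnC.
  move=> s2 t [ht ag2 [a2 hm2]]; wps; move: ht ag2 a2; sim; rewrite ag1 //= /update /= => ht ag2 a2.
  split; first lia.
    by agr; rewrite ag2; [upd | lia].
  by split => //; rewrite a2 expnS.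
move=> s1 t1; sim => -[ht1 ag1 [a1 hm1]]; wps; sim.
pose I2 (i a b : nat) (m : nat -> nat) := a = i * n ^ g /\ m = memory s.
apply: (wp_mono (wp_for_const (I := I2) (tb := 5) _ _ _)) => //.
  move=> i s2; sim => hi ag2 _ [a2 hm2]; wps; sim; split => //; first by agr.
  by split => //; rewrite a2 ag2 //= /update /= a1 mulSn addnC.
move=> s2 t2 /=; sim => -[ht2 ag2 [a2 hm2]]; wps; sim.
have r1 : regs s1 1 = n by rewrite ag1.
rewrite r1 in ht2 a2; split; first lia.
  split; rewrite /= /update /=.
  - by rewrite ag2 //= /update /= ag1.
  - by rewrite ag2 //= /update /= ag1.
  - by rewrite ag2 //= /update /= ag1 //= addn1.
  - by rewrite ag2.
  - by rewrite a2 expnS.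
exact: hm2.
Qed.

Lemma fill_mul_spec s : globals s ->
  wp fill_mul s (fun s' t => [/\ t <= n ^ g.+1 * 40 + 20, agree 5 s s',
    frame [:: 0] (memory s) (memory s') &
    forall k, k < n ^ g.+1 -> tab (memory s') 0 k = k * n]).
Proof.
move=> G; have [g0 g1 g2 g3 g4] := G; rewrite /fill_mul; wps; sim.
pose I1 (i a b : nat) (m : nat -> nat) := [/\ a = i * n, frame [:: 0] (memory s) m &
  forall k, k < i -> tab m 0 k = k * n].
apply: (wp_mono (wp_for_const (I := I1) (tb := 30) _ _ _)) => //.
  move=> i s1; sim => hi ag1 ri [a1 fr h]; wps; sim.
  have [e0 e1 _ _ _] : globals s1 by apply: (globals_agree _ ag1) => //; apply: globals_upd.
  rewrite e0 e1 ri a1; split => //; first by agr.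
  split; first by rewrite mulSn addnC.
    by apply: frame_trans fr _; apply: frame_put.
  move=> k hk; rewrite tab_put //=; case: eqP => [-> //|nk].
  by apply: h; lia.
move=> s1 t1; sim; rewrite g4 => -[ht1 ag1 [a1 fr h]]; split => //; first lia.
by agr; rewrite ag1 //; upd.
Qed.

Lemma fill_div_spec s : globals s ->
  (forall k, k < n ^ g.+1 -> tab (memory s) 0 k = k * n) ->
  wp fill_div s (fun s' t => [/\ t <= n ^ g.+1 * 300 + n ^ g * 20 + 20, agree 5 s s',
    frame [:: 1] (memory s) (memory s') &
    forall q, q < n ^ g.+1 -> tab (memory s') 1 q = q %/ n]).
Proof.
move=> G hmul; have [g0 g1 g2 g3 g4] := G; rewrite /fill_div.
pose I1 (i a b : nat) (m : nat -> nat) := frame [:: 1] (memory s) m /\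
  forall q, q < i * n -> tab m 1 q = q %/ n.
apply: (wp_mono (wp_for_const (I := I1) (tb := n * 270 + 5) _ _ _)) => //.
  move=> i s1; rewrite g3 => hi ag1 ri [fr h].
  have G1 := globals_agree (isT : 5 <= 5) ag1 G; have [e0 e1 _ _ _] := G1.
  pose I2 (c a b : nat) (m : nat -> nat) := frame [:: 1] (memory s) m /\
    forall q, q < i * n + c -> tab m 1 q = q %/ n.
  apply: (wp_mono (wp_for_const (I := I2) (tb := 260) _ _ _)) => //.
  - by split => // q; rewrite addn0; apply: h.
  - move=> c s2; rewrite e1 => hc ag2 rc [fr2 h2]; wps; sim.
    have [e0' e1' _ _ _] := globals_agree (isT : 5 <= 6) ag2 G1.
    have ri2 : regs s2 5 = i by rewrite ag2.
    have mi : tab (memory s2) 0 i = i * n.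
      by rewrite (fr2.2) // hmul // (leq_trans hi) // leq_pexp2l.
    rewrite e0' ri2 rc mi; split => //.
    split; first by apply: frame_trans fr2 _; apply: frame_put.
    move=> q hq; rewrite tab_put //=; case: eqP => [-> |nq].
      by rewrite divnMDl // divn_small // addn0.
    by apply: h2; lia.
  move=> s2 t2; rewrite e1 => -[ht2 ag2 [fr2 h2]]; split => //; first lia.
  by split => // q hq; apply: h2; rewrite addnC -mulSn.
move=> s1 t1; rewrite g3 => -[ht1 ag1 [fr h]]; split => //; last by rewrite expnSr.
by rewrite expnSr; lia.
Qed.

Lemma fill_top_spec s : globals s ->
  wp fill_top s (fun s' t => [/\ t <= n ^ g.+1 * 60 + n * 80 + 20, agree 5 s s',
    frame [:: 2; 3] (memory s) (memory s'),
    forall q, q < n ^ g.+1 -> tab (memory s') 2 q = q %/ n ^ g &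
    forall k, k < n -> tab (memory s') 3 k = k * n ^ g]).
Proof.
move=> G; have [g0 g1 g2 g3 g4] := G; rewrite /fill_top; wps; sim.
pose I1 (i a b : nat) (m : nat -> nat) := [/\ a = i * n ^ g, frame [:: 2; 3] (memory s) m,
  forall q, q < i * n ^ g -> tab m 2 q = q %/ n ^ g &
  forall k, k < i -> tab m 3 k = k * n ^ g].
apply: (wp_mono (wp_for_const (I := I1) (tb := n ^ g * 60 + 60) _ _ _)) => //.
  move=> i s1; sim; rewrite g1 => hi ag1 ri [a1 fr h h'].
  have G1 : globals s1 by apply: (globals_agree _ ag1) => //; apply: globals_upd.
  have [e0 e1 _ e3 _] := G1; wps; sim.
  rewrite e0 ri a1.
  pose m1 := tput B (memory s1) 3 i (i * n ^ g).
  have fr1 : frame [:: 2; 3] (memory s) m1 by apply: frame_trans fr _; apply: frame_put.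
  pose I2 (c a b : nat) (m : nat -> nat) := [/\ frame [:: 2] m1 m &
    forall q, q < i * n ^ g + c -> tab m 2 q = q %/ n ^ g].
  apply: (wp_mono (wp_for_const (I := I2) (tb := 50) _ _ _)) => //.
  - by split => // q; rewrite addn0 tab_put //=; apply: h.
  - move=> c s2 /=; rewrite e3 => hc ag2 rc [fr2 h2]; wps; sim.
    have [e0' _ _ _ _] := globals_agree (isT : 5 <= 7) ag2 G1.
    rewrite e0' (ag2 5) // (ag2 6) //= ri a1 rc; split => //.
    split; first by apply: frame_trans fr2 _; apply: frame_put.
    move=> q hq; rewrite tab_put //=; case: eqP => [-> |nq].
      by rewrite divnMDl ?expn_gt0 // divn_small // addn0.
    by apply: h2; lia.
  move=> s2 t2 /=; rewrite e3 => -[ht2 ag2 [fr2 h2]]; wps; sim.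
  rewrite (ag2 6) // (ag2 3) //= a1 e3; split; first lia.
    by agr; rewrite ag2 //; lia.
  split; first by rewrite mulSn addnC.
  - by apply: frame_trans fr1 _; apply: frameW fr2.
  - by move=> q hq; apply: h2; rewrite addnC -mulSn.
  - move=> k hk; rewrite (fr2.2) // tab_put //=; case: eqP => [-> //|nk].
    by apply: h'; lia.
move=> s1 t1; sim; rewrite g1 => -[ht1 ag1 [a1 fr h h']]; split => //.
- by rewrite expnS; lia.
- by agr; rewrite ag1 //; upd.
- by rewrite expnS.
Qed.
End Tables.

(** * Distances between vertices, and from vertices to windows *)

Definition dist_init : prog :=
  For 5 1 (For 6 1
    (If (Reg 5) (Reg 6) (Put 4 (Add (Get 0 (Reg 5)) (Reg 6)) (Reg 1))
    (If (Reg 6) (Reg 5) (Put 4 (Add (Get 0 (Reg 5)) (Reg 6)) (Reg 1))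
                        (Put 4 (Add (Get 0 (Reg 5)) (Reg 6)) (Const 0))))).

(** Registers 5, 6 and 7 hold the round, the source [u] and a vertex [v]. The difference of
    consecutive offsets is the degree of [v], and register 10 runs through its adjacency list. *)
Definition dist_relax : prog :=
  For 5 1 (For 6 1 (For 7 1
    (Seq (Assign 8 (Defs.Sub (Defs.Mem (Add (Const 4) (Reg 7))) (Defs.Mem (Add (Const 3) (Reg 7)))))
    (Seq (Assign 9 (Defs.Mem (Add (Const 3) (Reg 7))))
         (For 10 8
           (Seq (Assign 11 (Add (Get 0 (Reg 6)) (Defs.Mem (Add (Reg 9) (Reg 10)))))
           (Seq (Assign 12 (Add (Get 4 (Add (Get 0 (Reg 6)) (Reg 7))) (Const 1)))
                (If (Reg 12) (Get 4 (Reg 11)) (Put 4 (Reg 11) (Reg 12)) Skip)))))))).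

(** Register 8 holds [q] with its last digits removed; the next digit is the remainder, found by
    subtracting the tabulated [n]-fold quotient. Register 9 holds the minimum so far. *)
Definition fill_wdist : prog :=
  For 5 4 (For 6 1
    (Seq (Assign 8 (Reg 5))
    (Seq (Assign 9 (Reg 1))
    (Seq (For 7 2
           (Seq (Assign 10 (Get 0 (Get 1 (Reg 8))))
           (Seq (Assign 10 (Get 0 (Defs.Sub (Reg 8) (Reg 10))))
           (Seq (Assign 10 (Get 4 (Add (Reg 10) (Reg 6))))
           (Seq (If (Reg 10) (Reg 9) (Assign 9 (Reg 10)) Skip)
                (Assign 8 (Get 1 (Reg 8))))))))
         (Put 5 (Add (Get 0 (Reg 5)) (Reg 6)) (Reg 9)))))).

Lemma index2_eq n a b c d : b < n -> d < n -> (a * n + b == c * n + d) = (a == c) && (b == d).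
Proof.
move=> hb hd; apply/eqP/andP => [h|[/eqP -> /eqP -> //]].
have n0 : 0 < n by lia.
have := congr1 (fun x => x %/ n) h; have := congr1 (fun x => x %% n) h.
by rewrite /= !divnMDl // !modnMDl !(divn_small, modn_small) // !addn0 => -> ->; rewrite !eqxx.
Qed.

Lemma index2_lt n k a b : a < k -> b < n -> a * n + b < k * n.
Proof.
move=> ha hb; apply: (@leq_trans (a.+1 * n)); first by rewrite mulSn; lia.
by rewrite leq_mul2r ha orbT.
Qed.

Section Distances.

Variables (n' g B : nat) (e : rel 'I_n'.+1) (nb : 'I_n'.+1 -> seq 'I_n'.+1).
Local Notation n := n'.+1.
Local Notation T := 'I_n.
Local Notation tab := (tab B).
Local Notation frame := (frame B).
Local Notation globals := (globals n' g B).

Hypotheses (e_irr : irreflexive e)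
  (e_conn : forall u v, connect e u v) (nbP : adjacency_lists e nb).

Definition input_ok (m : nat -> nat) : Prop :=
  [/\ 3 + n < B, forall v : T, m (4 + v) = m (3 + v) + size (nb v) &
    forall (v : T) p, p < size (nb v) ->
      m (3 + v) + p < B /\ m (m (3 + v) + p) = nth ord0 (nb v) p].

Lemma input_frame js m m' : frame js m m' -> input_ok m -> input_ok m'.
Proof.
move=> [fr _] [h1 h2 h3].
have lo (v : T) : 3 + v < B by have := ltn_ord v; lia.
have lo' (v : T) : 4 + v < B by have := ltn_ord v; lia.
split => // [v|v p hp]; first by rewrite !fr.
by have [h4 h5] := h3 v p hp; rewrite !fr.
Qed.

Definition mul_ok (m : nat -> nat) := forall k, k < n ^ g.+1 -> tab m 0 k = k * n.

Lemma mul_okT m (u : nat) : mul_ok m -> u < n -> tab m 0 u = u * n.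
Proof.
move=> h hu; apply: h; apply: leq_trans hu _.
by rewrite -{1}(expn1 n) leq_pexp2l.
Qed.

Lemma mul_frame js m m' : 0 \notin js -> frame js m m' -> mul_ok m -> mul_ok m'.
Proof. by move=> hj fr h k hk; rewrite (fr.2) // h. Qed.

Definition dtab (m : nat -> nat) (u x : T) := tab m 4 (u * n + x).

Lemma dist_init_spec s : globals s -> mul_ok (memory s) ->
  wp dist_init s (fun s' t => [/\ t <= n * (n * 320) + n * 20 + 20, agree 5 s s',
    frame [:: 4] (memory s) (memory s') &
    forall u x : T, dtab (memory s') u x = if u == x then 0 else n]).
Proof.
move=> G hmul; have [g0 g1 g2 g3 g4] := G; rewrite /dist_init.
pose val (u x : T) := if u == x then 0 else n.
pose I1 (i a b : nat) (m : nat -> nat) := frame [:: 4] (memory s) m /\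
  forall u x : T, u < i -> dtab m u x = val u x.
apply: (wp_mono (wp_for_const (I := I1) (tb := n * 310 + 5) _ _ _)) => //.
  move=> i s1; rewrite g1 => hi ag1 ri [fr h].
  have G1 := globals_agree (isT : 5 <= 5) ag1 G; have [e0 e1 _ _ _] := G1.
  pose I2 (c a b : nat) (m : nat -> nat) := frame [:: 4] (memory s) m /\
    forall u x : T, (u < i) || (u == i :> nat) && (x < c) -> dtab m u x = val u x.
  apply: (wp_mono (wp_for_const (I := I2) (tb := 300) _ _ _)) => //.
  - by split => // u x; rewrite ltn0 andbF orbF; apply: h.
  - move=> c s2; rewrite e1 => hc ag2 rc [fr2 h2].
    have [e0' e1' _ _ _] := globals_agree (isT : 5 <= 6) ag2 G1.
    have ri2 : regs s2 5 = i by rewrite ag2.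
    have mi : tab (memory s2) 0 i = i * n.
      by apply: mul_okT => //; apply: (mul_frame _ fr2).
    have key v t : v = (if i == c then 0 else n) -> t <= 300 ->
      [/\ t <= 300, agree 7 s2 (State (regs s2) (tput B (memory s2) 4 (i * n + c) v)) &
       I2 c.+1 (regs s2 7) (regs s2 8) (tput B (memory s2) 4 (i * n + c) v)].
      move=> vE ht; split => //; split.
        by apply: frame_trans fr2 _; apply: frame_put.
      move=> u x hux; rewrite /dtab tab_put //= index2_eq //.
      case: ifP => [/andP [/eqP ui /eqP xc]|nux]; first by rewrite vE -ui -xc.
      apply: h2; move: hux nux; rewrite ltnS (leq_eqVlt x).
      by case: (u < i) => //=; case: (u == i :> nat) => //=; case: (x == c :> nat).
    apply: wp_if; sim; rewrite ri2 rc => hic; wps; sim; rewrite ?e0' ?e1' ?ri2 ?rc ?mi.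
      by apply: key => //; rewrite ltn_eqF.
    apply: wp_if; sim; rewrite ri2 rc => hci; wps; sim; rewrite ?e0' ?e1' ?ri2 ?rc ?mi.
      by apply: key => //; rewrite gtn_eqF.
    by apply: key => //; rewrite eqn_leq hic hci.
  move=> s2 t2; rewrite e1 => -[ht2 ag2 [fr2 h2]]; split => //; first lia.
  split => // u x; rewrite ltnS leq_eqVlt => hu; apply: h2.
  by rewrite ltn_ord andbT orbC.
move=> s1 t1; rewrite g1 => -[ht1 ag1 [fr h]]; split => //; first lia.
by move=> u x; apply: h.
Qed.

Definition relaxed i (m : nat -> nat) u v w :=
  dist e u v <= i -> dtab m u w <= (dist e u v).+1.

(** After [i] rounds, entries for distances up to [i] are exact and no entry is ever too small. The
    last clause records the progress within the current round. *)
Definition relax_inv m0 i (S : T -> T -> T -> Prop) m :=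
  [/\ frame [:: 4] m0 m, forall u w, dist e u w <= dtab m u w,
    forall u w, dist e u w <= i -> dtab m u w <= dist e u w &
    forall u v w, S u v w -> relaxed i m u v w].

(** Updating in place is harmless: entries only decrease while staying above the distance, so an
    entry already improved in the same round can be read as well. *)
Lemma relax_inv_step m0 i (S S' : T -> T -> T -> Prop) m m' u v w :
  relax_inv m0 i S m -> e v w -> frame [:: 4] m m' ->
  (forall a b, dtab m' a b =
    if (a == u) && (b == w) then minn (dtab m u w) (dtab m u v).+1 else dtab m a b) ->
  (forall a b c, S' a b c -> S a b c \/ [/\ a = u, b = v & c = w]) ->
  relax_inv m0 i S' m'.
Proof.
move=> [fr lo up rl] ew fr' hm' hS.
have dec a b : dtab m' a b <= dtab m a b.
  by rewrite hm'; case: ifP => // /andP [/eqP -> /eqP ->]; rewrite geq_minl.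
split.
- exact: frame_trans fr fr'.
- move=> a b; rewrite hm'; case: ifP => // /andP [/eqP -> /eqP ->].
  rewrite leq_min lo /=; apply: leq_trans (dist_triangle e_conn u v w) _.
  by rewrite (dist_edge e_irr e_conn ew) addn1 ltnS.
- by move=> a b h; apply: leq_trans (dec a b) (up _ _ h).
move=> a b c /hS [h hab|[-> -> ->] huv]; first exact: leq_trans (dec a c) (rl _ _ _ h hab).
rewrite hm' !eqxx /=; apply: leq_trans (geq_minr _ _) _.
by rewrite ltnS; apply: up.
Qed.

(* The edges handled so far in a round, in the order of the three inner loops. *)
Definition lexS (j l c : nat) (u v w : T) : Prop :=
  e v w /\ ((u < j) || (u == j :> nat) && ((v < l) || (v == l :> nat) && (index w (nb v) < c))).

Lemma relax_invW m0 i (S S' : T -> T -> T -> Prop) m :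
  (forall u v w, S' u v w -> S u v w) -> relax_inv m0 i S m -> relax_inv m0 i S' m.
Proof. by move=> h [h1 h2 h3 h4]; split => // u v w /h; apply: h4. Qed.

(** Indexed by numbers instead of vertices, to match the sums over loop counters produced by
    [wp_for]. *)
Definition degsum := \sum_(0 <= v < n) size (nb (inord v)).

Lemma dist_relax_spec s : globals s -> mul_ok (memory s) -> input_ok (memory s) ->
  (forall u x : T, dtab (memory s) u x = if u == x then 0 else n) ->
  wp dist_relax s (fun s' t =>
    [/\ t <= n * (n * (degsum * 407 + n * 67 + 12) + 12) + 5, agree 5 s s',
    frame [:: 4] (memory s) (memory s') &
    forall u x : T, dtab (memory s') u x = dist e u x]).
Proof.
move=> G hmul hin hini; have [g0 g1 g2 g3 g4] := G; rewrite /dist_relax.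
have dn u v : dist e u v < n by have := dist_lt_card (e_conn u v); rewrite card_ord.
pose I1 (i a b : nat) (m : nat -> nat) := relax_inv (memory s) i (fun _ _ _ => False) m.
apply: (wp_mono (wp_for_const (I := I1) (tb := n * (degsum * 407 + n * 67 + 12) + 5) _ _ _)) => //.
- split => // u w; rewrite hini; first by case: eqP => [->|_]; rewrite ?dist_refl // ltnW.
  by rewrite leqn0 => /eqP /(dist_eq0 e_conn) ->; rewrite eqxx.
- move=> i s1; rewrite g1 => hi ag1 ri inv1.
  have G1 := globals_agree (isT : 5 <= 5) ag1 G; have [_ e1 _ _ _] := G1.
  pose I2 (j a b : nat) (m : nat -> nat) := relax_inv (memory s) i (lexS j 0 0) m.
  apply: (wp_mono (wp_for_const (I := I2) (tb := degsum * 407 + n * 67 + 5) _ _ _)) => //.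
  + apply: relax_invW inv1 => u v w [_]; by rewrite !ltn0 andbF /= andbF.
  + move=> j s2; rewrite e1 => hj ag2 rj inv2.
    have G2 := globals_agree (isT : 5 <= 6) ag2 G1; have [_ e2 _ _ _] := G2.
    pose I3 (l a b : nat) (m : nat -> nat) := relax_inv (memory s) i (lexS j l 0) m.
    apply: (wp_mono (wp_for (I := I3) (tb := fun l => size (nb (inord l)) * 407 + 60) _ _ _)) => //.
      move=> l s3; rewrite e2 => hl ag3 rl inv3.
      have G3 := globals_agree (isT : 5 <= 7) ag3 G2.
      pose v : T := Ordinal hl.
      have vE : inord l = v by apply: val_inj; rewrite /= inordK.
      have [_ inv3a inv3b] : input_ok (memory s3) by case: inv3 => fr _ _ _; apply: (input_frame fr hin).
      wps; sim; rewrite rl.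
      have -> : memory s3 (4 + l) = memory s3 (3 + l) + size (nb v) := inv3a v.
      rewrite addKn vE.
      pose I4 (c a b : nat) (m : nat -> nat) := relax_inv (memory s) i (lexS j l c) m.
      apply: (wp_mono (wp_for_const (I := I4) (tb := 400) _ _ _)) => //; sim.
        move=> c s4 hc ag4 rc inv4.
        have G4 : globals s4.
          by apply: (globals_agree (isT : 5 <= 5) _ G3); agr; rewrite ag4; [upd | lia].
        have [e0 _ _ _ _] := G4.
        have r6 : regs s4 6 = j by rewrite ag4 //= /update /= ag3.
        have r7 : regs s4 7 = l by rewrite ag4 //= /update /=.
        have r9 : regs s4 9 = memory s3 (3 + l) by rewrite ag4.
        have [fr4 _ _ _] := inv4; have [fr3 _ _ _] := inv3.
        have [_ inv4a inv4b] : input_ok (memory s4) := input_frame fr4 hin.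
        have mE : memory s3 (3 + l) = memory s4 (3 + l).
          by rewrite (fr4.1) ?(fr3.1) //; case: hin => hB _ _; lia.
        have [_ wE] := inv4b v c hc.
        set w := nth ord0 (nb v) c in wE.
        have mj : tab (memory s4) 0 j = j * n.
          by apply: mul_okT => //; apply: (mul_frame _ fr4).
        pose u : T := Ordinal hj.
        have wnb : w \in nb v by apply: mem_nth.
        have ew : e v w by rewrite -(nbP v).2.
        have stepS a b x : lexS j l c.+1 a b x -> lexS j l c a b x \/ [/\ a = u, b = v & x = w].
          move=> [ebx]; rewrite /lexS ltnS (leq_eqVlt (index _ _)).
          case: ltnP => //= _; first by left.
          case: (a =P j :> nat) => //= aj; case: ltnP => //= _; first by left.
          case: (b =P l :> nat) => //= bl /orP [/eqP hx|->]; last by left.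
          right; have bv : b = v by apply: val_inj.
          split => //; first exact: val_inj.
          by rewrite /w -hx bv nth_index // (nbP v).2 -bv.
        wps; sim; apply: wp_if; sim; rewrite e0 r6 r7 rc r9 mE.
          have -> : memory s4 (memory s4 (3 + l) + c) = w by [].
          rewrite mj => hlt; wps; sim; split; [lia | by agr |].
          apply: (relax_inv_step inv4 ew _ _ stepS); rewrite /= ?mj ?e0.
            exact: frame_put.
          move=> a b; rewrite /dtab tab_put //= index2_eq //.
          case: ifP => // _; rewrite addn1 in hlt *; symmetry.
          by apply/minn_idPr; rewrite ltnW.
        have -> : memory s4 (memory s4 (3 + l) + c) = w by [].
        rewrite mj => hge; wps; sim; split; [lia | by agr |].
        apply: (relax_inv_step inv4 ew _ _ stepS) => // a b.
        case: ifP => // /andP [/eqP -> /eqP ->]; symmetry; apply/minn_idPl.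
        by rewrite addn1 in hge.
      move=> s4 t4 [ht4 ag4 inv4]; split; first by lia.
        by agr; rewrite ag4 /= /update; [upd | lia].
      apply: relax_invW inv4 => a b x [ebx]; rewrite /lexS ltn0 andbF orbF ltnS (leq_eqVlt b) => h.
      split => //; case/orP: h => [->//|/andP [-> /= hb]]; apply/orP; right.
      case/orP: hb => [hb|-> //]; rewrite hb; apply/orP; right.
      by have -> : v = b; [apply: val_inj; rewrite /= (eqP hb) | rewrite index_mem (nbP b).2].
    move=> s3 t3; rewrite e2 => -[ht3 ag3 inv3]; split => //.
      apply: leq_trans ht3 _; rewrite /degsum.
      rewrite (eq_bigr (fun l => size (nb (inord l)) * 407 + 67)); last by move=> l _; lia.
      by rewrite big_split /= -big_distrl /= sum_nat_const_nat subn0; lia.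
    apply: relax_invW inv3 => a b x [ebx]; rewrite /lexS !ltn0 !andbF orbF ltnS (leq_eqVlt a) => h.
    split => //; case/orP: h => [->|-> //]; by rewrite ltn_ord orbT.
  + move=> s2 t2; rewrite e1 => -[ht2 ag2 [fr2 lo2 up2 rl2]]; split => //; first lia.
    split => // u w; rewrite leq_eqVlt => /orP [/eqP hd|]; last by rewrite ltnS; apply: up2.
    (* A vertex at distance [i + 1] has a neighbour at distance [i], and the edge from it has been
       relaxed in this round. *)
    have [v ev dv] := dist_pred e_irr e_conn hd.
    by rewrite hd -dv; apply: rl2; rewrite ?dv //; split => //; rewrite ltn_ord.
- move=> s1 t1; rewrite g1 => -[ht1 ag1 [fr lo up _]]; split => //; first lia.
  by move=> u x; apply/eqP; rewrite eqn_leq lo up // ltnW.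
Qed.

Definition div_ok (m : nat -> nat) := forall q, q < n ^ g.+1 -> tab m 1 q = q %/ n.

Lemma div_frame js m m' : 1 \notin js -> frame js m m' -> div_ok m -> div_ok m'.
Proof. by move=> hj fr h k hk; rewrite (fr.2) // h. Qed.

Definition dist_ok (m : nat -> nat) := forall u x : T, dtab m u x = dist e u x.

Lemma dist_frame js m m' : 4 \notin js -> frame js m m' -> dist_ok m -> dist_ok m'.
Proof. by move=> hj fr h u x; rewrite /dtab (fr.2) // -/(dtab m u x) h. Qed.

Definition wdist_ok (m : nat -> nat) :=
  forall q (x : T), q < n ^ g.+1 -> tab m 5 (q * n + x) = wdist g e q x.

Lemma mind_rcons R v x : mind e (rcons R v) x = minn (mind e R x) (dist e v x).
Proof. by rewrite (@eq_mind _ _ _ (v :: R)) 1?minnC // => y; rewrite mem_rcons. Qed.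

Lemma fill_wdist_spec s : globals s -> mul_ok (memory s) -> div_ok (memory s) ->
  dist_ok (memory s) ->
  wp fill_wdist s (fun s' t =>
    [/\ t <= n ^ g.+1 * (n * (g.+1 * 350 + 320) + 12) + 5, agree 5 s s',
    frame [:: 5] (memory s) (memory s') & wdist_ok (memory s')]).
Proof.
move=> G hmul hdiv hdist; have [g0 g1 g2 g3 g4] := G; rewrite /fill_wdist.
pose I1 (i a b : nat) (m : nat -> nat) := frame [:: 5] (memory s) m /\
  forall q (x : T), q < i -> tab m 5 (q * n + x) = wdist g e q x.
apply: (wp_mono (wp_for_const (I := I1) (tb := n * (g.+1 * 350 + 320) + 5) _ _ _)) => //.
  move=> q s1; rewrite g4 => hq ag1 rq [fr h].
  have G1 := globals_agree (isT : 5 <= 5) ag1 G; have [e0 e1 _ _ _] := G1.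
  pose I2 (c a b : nat) (m : nat -> nat) := frame [:: 5] (memory s) m /\
    forall q' (x : T), (q' < q) || (q' == q) && (x < c) -> tab m 5 (q' * n + x) = wdist g e q' x.
  apply: (wp_mono (wp_for_const (I := I2) (tb := g.+1 * 350 + 310) _ _ _)) => //.
  - by split => // u x; rewrite ltn0 andbF orbF; apply: h.
  - move=> c s2; rewrite e1 => hc ag2 rc [fr2 h2].
    have G2 := globals_agree (isT : 5 <= 6) ag2 G1; have [e0' e1' e2' _ _] := G2.
    have rq2 : regs s2 5 = q by rewrite ag2.
    have hmul2 := mul_frame (isT : 0 \notin [:: 5]) fr2 hmul.
    have hdiv2 := div_frame (isT : 1 \notin [:: 5]) fr2 hdiv.
    have hdist2 := dist_frame (isT : 4 \notin [:: 5]) fr2 hdist.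
    pose x : T := Ordinal hc.
    wps; sim; rewrite rq2 e1'.
    pose I3 (i a b : nat) (m : nat -> nat) := [/\ m = memory s2, a = q %/ n ^ i &
      b = mind e [seq inord (q %/ n ^ k %% n) | k <- iota 0 i] x].
    apply: (wp_mono (wp_for_const (I := I3) (tb := 340) _ _ _)) => //.
    + by split => //; rewrite ?expn0 ?divn1 //= card_ord.
    + move=> i s3; sim; rewrite e2' => hi ag3 ri [hm ha hb].
      have [e03 _ _ _ _] : globals s3.
        by apply: (globals_agree (isT : 5 <= 5) _ G2); agr; rewrite ag3; [upd | lia].
      have r6 : regs s3 6 = c by rewrite ag3.
      have qi : q %/ n ^ i < n ^ g.+1 by apply: leq_ltn_trans hq; apply: leq_div.
      wps; sim; rewrite e03 hm ha hdiv2 // hmul2; last first.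
        by apply: leq_ltn_trans qi; apply: leq_div.
      have -> : q %/ n ^ i - q %/ n ^ i %/ n * n = q %/ n ^ i %% n.
        by rewrite {1}(divn_eq (q %/ n ^ i) n) addKn.
      have hd : q %/ n ^ i %% n < n by rewrite ltn_mod.
      rewrite (mul_okT hmul2 hd) r6.
      pose u : T := Ordinal hd.
      have -> : tab (memory s2) 4 (q %/ n ^ i %% n * n + c) = dist e u x := hdist2 u x.
      have mE : mind e [seq inord (q %/ n ^ k %% n) | k <- iota 0 i.+1] x =
          minn (regs s3 9) (dist e u x).
        rewrite -[i.+1]addn1 iotaD map_cat cats1 mind_rcons -hb add0n; congr minn.
        by congr dist; apply: val_inj; rewrite /= inordK.
      have aE : q %/ n ^ i %/ n = q %/ n ^ i.+1 by rewrite -divnMA -expnSr.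
      apply: wp_if; sim => hlt; wps; sim; rewrite ?ha ?e03 ?hm ?hdiv2 //.
        split; [lia | by agr |]; split => //; rewrite mE; symmetry.
        by apply/minn_idPr; rewrite ltnW.
      split; [lia | by agr |]; split => //; rewrite mE; symmetry.
      exact/minn_idPl.
    + move=> s3 t3; sim; rewrite e2' => -[ht3 ag3 [hm ha hb]].
      have [e03 _ _ _ _] : globals s3.
        by apply: (globals_agree (isT : 5 <= 5) _ G2); agr; rewrite ag3; [upd | lia].
      have r6 : regs s3 6 = c by rewrite ag3.
      have r5 : regs s3 5 = q by rewrite ag3.
      wps; sim; rewrite e03 hm r5 r6 hmul2 // hb; split; first lia.
        by agr; rewrite ag3; [upd | lia].
      split; first by apply: frame_trans fr2 _; apply: frame_put.
      move=> q' y hq'; rewrite tab_put //= index2_eq //.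
      case: ifP => [/andP [/eqP -> /eqP xc]|nux].
        have -> : y = x by apply: val_inj.
        by [].
      apply: h2; move: hq' nux; rewrite ltnS (leq_eqVlt y).
      by case: (q' < q) => //=; case: (q' == q) => //=; case: (y == c :> nat).
  move=> s2 t2; rewrite e1 => -[ht2 ag2 [fr2 h2]]; split => //; first lia.
  split => // q' x; rewrite ltnS leq_eqVlt => hq'; apply: h2.
  by rewrite ltn_ord andbT orbC.
move=> s1 t1; rewrite g4 => -[ht1 ag1 [fr h]]; split => //; first lia.
Qed.

End Distances.

(** * Dynamic programming over windows *)

Definition IfEq (a b : expr) (A : prog) : prog := If a b Skip (If b a Skip A).

Lemma wp_ifeq a b A s (Q : state -> nat -> Prop) :
  (eval s a = eval s b -> wp A s (fun s' t => Q s' (2 * (cost a + cost b).+1 + t))) ->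
  (eval s a <> eval s b -> forall t, t <= 2 * (cost a + cost b).+1 + 1 -> Q s t) ->
  wp (IfEq a b A) s Q.
Proof.
move=> H1 H2; apply: wp_if => h; first by apply: wp_skip; apply: H2; lia.
apply: wp_if => h'; first by apply: wp_skip; apply: H2; lia.
have /H1 H : eval s a = eval s b by lia.
apply: (wp_mono H) => s' t.
by have -> : 2 * (cost a + cost b).+1 + t = (cost a + cost b).+1 + ((cost b + cost a).+1 + t) by lia.
Qed.

(** Used for counting layers: a vertex lies in at most one of them, so its shifts are paid for once
    although every layer scans all vertices. *)
Lemma sum_eq k d : \sum_(0 <= i < k) (d == i : nat) = (d < k).
Proof.
elim: k => [|k IH]; first by rewrite big_geq.
by rewrite big_nat_recr //= IH ltnS (leq_eqVlt d k); case: ltngtP.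
Qed.

Definition reset : prog :=
  For 7 4 (Seq (Put 7 (Reg 7) (Reg 1))
               (For 8 1 (Put 6 (Add (Get 0 (Reg 7)) (Reg 8)) (Reg 1)))).

Definition begin_source : prog :=
  Seq (Assign 8 (Const 0))
 (Seq (For 7 2 (Assign 8 (Add (Get 3 (Reg 5)) (Get 1 (Reg 8)))))
 (Seq (Put 7 (Reg 8) (Const 0))
      (For 9 1 (Put 6 (Add (Get 0 (Reg 8)) (Reg 9)) (Get 4 (Add (Get 0 (Reg 5)) (Reg 9))))))).

(** Registers 7, 8 and 9 hold the layer, a vertex [u] in it and a neighbour [w] in the next layer;
    edges are recognised by distance 1. Register 10 runs over the lower digits, so all [n ^ g]
    windows with leading vertex [u] are visited, whether or not a path has them; unrealised windows
    keep the value [n]. *)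
Definition for_trans (body : prog) : prog :=
  For 7 1 (For 8 1
    (IfEq (Get 4 (Add (Get 0 (Reg 5)) (Reg 8))) (Reg 7)
      (For 9 1
        (IfEq (Get 4 (Add (Get 0 (Reg 8)) (Reg 9))) (Const 1)
        (IfEq (Get 4 (Add (Get 0 (Reg 5)) (Reg 9))) (Add (Reg 7) (Const 1))
          (For 10 3
            (Seq (Assign 11 (Add (Get 3 (Reg 8)) (Reg 10)))
            (Seq (Assign 12 (Add (Get 3 (Reg 9)) (Get 1 (Reg 11))))
                 body)))))))).

Section Main.

Variables (n' g B : nat) (e : rel 'I_n'.+1) (nb : 'I_n'.+1 -> seq 'I_n'.+1).
Local Notation n := n'.+1.
Local Notation T := 'I_n.
Local Notation N := (n ^ g.+1).
Local Notation P := (n ^ g).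
Local Notation tab := (tab B).
Local Notation frame := (frame B).
Local Notation globals := (globals n' g B).
Local Notation step := (step n' g).
Local Notation top := (top n' g).
Local Notation code := (code n' g).
Local Notation start := (start n' g).

Hypotheses (e_sym : symmetric e) (e_irr : irreflexive e)
  (e_conn : forall u v, connect e u v) (nbP : adjacency_lists e nb).

Definition tables_ok (m : nat -> nat) : Prop :=
  [/\ mul_ok n' g B m, div_ok n' g B m,
      (forall q, q < N -> tab m 2 q = q %/ P) /\ (forall k, k < n -> tab m 3 k = k * P),
      dist_ok B e m & wdist_ok g B e m].

(** The cells below [B] are left out, so the lemma also covers the memory after the output has
    overwritten the input. *)
Lemma tables_frame (js : seq nat) m m' : all (fun j => j \in [:: 6; 7; 8]) js ->
  (forall j i, j < 9 -> j \notin js -> tab m' j i = tab m j i) ->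
  tables_ok m -> tables_ok m'.
Proof.
move=> /allP hj fr [h0 h1 [h2 h3] h4 h5].
have nj j : j < 6 -> j \notin js.
  by move=> hj6; apply/negP => /hj; rewrite !inE; lia.
split=> [k hk|q hq||u x|q x hq]; rewrite ?/dtab ?fr ?nj //; try by [apply: h0|apply: h1|apply: h4|apply: h5].
by split => [q hq|k hk]; rewrite fr ?nj //; [apply: h2 | apply: h3].
Qed.

Lemma tables_frame6 js m m' : all (fun j => j \in [:: 6; 7; 8]) js -> frame js m m' ->
  tables_ok m -> tables_ok m'.
Proof. by move=> hj [_ fr]; apply: tables_frame fr. Qed.

Definition mtab (m : nat -> nat) (q : nat) (x : T) := tab m 6 (q * n + x).

Section Source.

Variable (s : T).

Lemma reset_spec st : globals st -> tables_ok (memory st) ->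
  wp reset st (fun st' t => [/\ t <= N * (n * 300 + 60) + 5, agree 7 st st',
    frame [:: 6; 7] (memory st) (memory st') &
    forall q, q < N -> tab (memory st') 7 q = n /\ forall x, mtab (memory st') q x = n]).
Proof.
move=> G [hmul _ _ _ _]; have [g0 g1 g2 g3 g4] := G; rewrite /reset.
pose I1 (i a b : nat) (m : nat -> nat) := frame [:: 6; 7] (memory st) m /\
  forall q, q < i -> tab m 7 q = n /\ forall x, mtab m q x = n.
apply: (wp_mono (wp_for_const (I := I1) (tb := n * 300 + 50) _ _ _)) => //.
move=> q s1; rewrite g4 => hq ag1 rq [fr h].
have G1 := globals_agree (isT : 5 <= 7) ag1 G; have [e0 e1 _ _ _] := G1.
wps; sim; rewrite e0 rq e1.
pose I2 (c a b : nat) (m : nat -> nat) := frame [:: 6; 7] (memory st) m /\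
  forall q', q' <= q -> tab m 7 q' = n /\ forall x : T, (q' < q) || (x < c) -> mtab m q' x = n.
apply: (wp_mono (wp_for_const (I := I2) (tb := 290) _ _ _)) => //.
- split; first by apply: frame_trans fr _; apply: frame_put.
  move=> q' hq'; rewrite tab_put //=; split.
    by case: eqP => // nq; apply: (h q' _).1; lia.
  by move=> x; rewrite orbF /mtab tab_put //= => hqq; apply: (h q' hqq).2.
- move=> c s2 /=; rewrite e1 => hc ag2 rc [fr2 h2]; wps; sim.
  have [e0' e1' _ _ _] := globals_agree (isT : 5 <= 8) ag2 G1.
  have rq2 : regs s2 7 = q by rewrite ag2.
  have mq : tab (memory s2) 0 q = q * n by rewrite (fr2.2) // hmul.
  rewrite e0' rq2 rc mq e1'; split => //.
  split; first by apply: frame_trans fr2 _; apply: frame_put.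
  move=> q' hq'; rewrite tab_put //=; have [h3 h4] := h2 q' hq'; split => // x hx.
  rewrite /mtab tab_put //= index2_eq //; case: ifP => // nqx; apply: h4.
  by move: hx nqx hq'; rewrite ltnS (leq_eqVlt x) (leq_eqVlt q'); case: (q' == q); case: (x == c :> nat); case: (q' < q).
- move=> s2 t2 /=; rewrite e1 => -[ht2 ag2 [fr2 h2]]; split => //; first lia.
  by split => // q'; rewrite ltnS => hq'; have [h3 h4] := h2 q' hq'; split => // x; apply: h4; rewrite ltn_ord orbT.
move=> s1 t1; rewrite g4 => -[ht1 ag1 [fr h]]; split => //; lia.
Qed.

Lemma begin_source_spec st : globals st -> tables_ok (memory st) -> regs st 5 = s ->
  (forall q, q < N -> tab (memory st) 7 q = n /\ forall x, mtab (memory st) q x = n) ->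
  wp begin_source st (fun st' t => [/\ t <= g.+1 * 70 + n * 520 + 60, agree 7 st st',
    frame [:: 6; 7] (memory st) (memory st') &
    forall q, q < N -> tab (memory st') 7 q = (if q == start s then 0 else n) /\
      forall x, mtab (memory st') q x = if q == start s then dist e s x else n]).
Proof.
move=> G [hmul hdiv [htop hmulp] hdist _] r5 hini.
have [g0 g1 g2 g3 g4] := G; rewrite /begin_source; wps; sim.
pose I1 (i a b : nat) (m : nat -> nat) := a = iter i (fun q => step q s) 0 /\ m = memory st.
apply: (wp_mono (wp_for_const (I := I1) (tb := 60) _ _ _)) => //.
  move=> i s1; sim; rewrite g2 => hi ag1 ri [ha hm]; wps; sim.
  have [e0 _ _ _ _] : globals s1.
    by apply: (globals_agree (isT : 5 <= 5) _ G); agr; rewrite ag1; [upd | lia].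
  have r5' : regs s1 5 = s by rewrite ag1.
  rewrite e0 r5' hm ha hmulp // hdiv ?start_iter_lt //; split => //.
  by agr.
move=> s1 t1; sim; rewrite g2 => -[ht1 ag1 [ha hm]].
have G1 : globals s1 by apply: (globals_agree (isT : 5 <= 5) _ G); agr; rewrite ag1; [upd | lia].
have [e0 e1 _ _ _] := G1; wps; sim; rewrite e0 ha hm -/(start s).
have sN : start s < N by rewrite start_iter_lt.
have r5' : regs s1 5 = s by rewrite ag1.
pose m1 := tput B (memory st) 7 (start s) 0.
pose I2 (c a b : nat) (m : nat -> nat) := frame [:: 6] m1 m /\
  forall q (x : T), mtab m q x = if (q == start s) && (x < c) then dist e s x else mtab m1 q x.
apply: (wp_mono (wp_for_const (I := I2) (tb := 510) _ _ _)) => //.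
- by split => // q x; rewrite andbF.
- move=> c s2 /=; rewrite e1 => hc ag2 rc [fr2 h2]; wps; sim.
  have [e0' e1' _ _ _] := globals_agree (isT : 5 <= 9) ag2 G1.
  have r8 : regs s2 8 = start s by rewrite ag2.
  have r52 : regs s2 5 = s by rewrite ag2.
  have tE j i : j < 6 -> tab (memory s2) j i = tab (memory st) j i.
    move=> hj; rewrite (fr2.2) ?tab_put ?inE //; try lia.
    by case: ifP => // /andP [/eqP hj7]; lia.
  rewrite e0' r8 rc r52 !tE // !hmul //; last by rewrite (leq_trans (ltn_ord s)) // -{1}(expn1 n) leq_pexp2l.
  pose x : T := Ordinal hc.
  have -> : tab (memory st) 4 (s * n + c) = dist e s x := hdist s x.
  split => //; split; first by apply: frame_trans fr2 _; apply: frame_put.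
  move=> q y; rewrite /mtab tab_put //= index2_eq // -/(mtab _ _ _) h2 ltnS (leq_eqVlt y).
  case: (q == start s) => //=; case: (y =P c :> nat) => //= yc.
  by have -> : y = x by apply: val_inj.
- move=> s2 t2 /=; rewrite e1 => -[ht2 ag2 [fr2 h2]]; split; first lia.
  + by agr; rewrite ag2 ?ag1 //=; [upd | lia].
  + apply: frame_trans (frameW _ fr2) => //.
    exact: frame_put.
  + move=> q hq; have [h3 h4] := hini q hq; rewrite (fr2.2) // tab_put //= h3; split => // x.
    by rewrite h2 ltn_ord andbT /mtab tab_put //= -/(mtab _ _ _) h4.
Qed.

Definition lay (q : nat) : nat := dist e s (top q).

(* The shifts handled so far, in the order of the loops of [for_trans].  Layers
   come first, so that the source of a shift is final when the shift is handled. *)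
Definition lex (i j l c q : nat) (w : T) : Prop :=
  [/\ q < N, trans g e s q w &
   (lay q < i) || (lay q == i) && ((q %/ P < j) || (q %/ P == j) &&
     ((w < l) || (w == l :> nat) && (q %% P < c)))].

Definition outdeg (j : nat) : nat := size (nb (inord j)).

Lemma sum_edge (u : T) : \sum_(0 <= w < n) (e u (inord w) : nat) = size (nb u).
Proof.
have [un hn] := nbP u.
rewrite big_mkord -(card_uniqP un) -sum1_card [RHS]big_mkcond /=.
apply: eq_bigr => w _; rewrite inord_val -hn; by case: (w \in nb u).
Qed.

(** The loop is verified once for both passes: [K S m] relates the memory to the set [S] of shifts
    handled so far. The body learns that these start in layers up to that of [q]; since it writes to
    a window of the next layer, the source windows of handled shifts stay as they are. *)
Lemma for_trans_spec body (K : (nat -> T -> Prop) -> (nat -> nat) -> Prop) tb st :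
  globals st -> tables_ok (memory st) -> regs st 5 = s ->
  (forall S m, K S m -> frame [:: 6; 7; 8] (memory st) m) ->
  (forall (S S' : nat -> T -> Prop) m, (forall q w, S' q w -> S q w) -> K S m -> K S' m) ->
  (forall (S : nat -> T -> Prop) q (w : T) st', globals st' -> regs st' 9 = w ->
     regs st' 11 = q -> regs st' 12 = step q w -> K S (memory st') ->
     q < N -> trans g e s q w ->
     (forall q' w', S q' w' -> q' < N /\ lay q' <= lay q) ->
     wp body st' (fun st'' t => [/\ t <= tb, agree 13 st' st'' &
       K (fun q' w' => S q' w' \/ (q' = q /\ w' = w)) (memory st'')])) ->
  K (fun _ _ => False) (memory st) ->
  wp (for_trans body) st (fun st' t =>
    [/\ t <= n * (n * 1600 + 12) + 5 + degsum nb * (P * (tb + 300) + 5), agree 7 st st' &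
     K (fun q w => q < N /\ trans g e s q w) (memory st')]).
Proof.
move=> G tok r5 Kfr Kmono Kbody K0; have [g0 g1 g2 g3 g4] := G; rewrite /for_trans.
(* A bound for the work at vertex [j] in its layer: a scan of [n] candidates and [n ^ g] runs of the
   body for each neighbour. *)
pose X j := n * 1000 + outdeg j * (P * (tb + 300) + 5).
have P0 : 0 < P by rewrite expn_gt0.
have NE : N = n * P by rewrite expnS.
have topE q : q < N -> (top q : nat) = q %/ P.
  by move=> hq; rewrite /top inordK // ltn_divLR // -NE.
pose I1 (i a b : nat) (m : nat -> nat) := K (lex i 0 0 0) m.
pose t1 i := n * 520 + 5 + \sum_(0 <= j < n) (dist e s (inord j) == i) * X j.
have tabs m S : K S m -> tables_ok m by move=> /Kfr fr; apply: (tables_frame6 _ fr).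
apply: (wp_mono (wp_for (I := I1) (tb := t1) _ _ _)) => //.
- by apply: Kmono K0 => q w [_ _]; rewrite !ltn0 !andbF /= ?andbF.
- move=> i s1; rewrite g1 => hi ag1 ri K1.
  have G1 := globals_agree (isT : 5 <= 7) ag1 G; have [_ e1 _ _ _] := G1.
  pose I2 (j a b : nat) (m : nat -> nat) := K (lex i j 0 0) m.
  pose t2 j := 513 + (dist e s (inord j) == i) * X j.
  apply: (wp_mono (wp_for (I := I2) (tb := t2) _ _ _)) => //.
  + move=> j s2; rewrite e1 => hj ag2 rj K2.
    have G2 := globals_agree (isT : 5 <= 8) ag2 G1; have [f0 f1 _ _ _] := G2.
    have r52 : regs s2 5 = s by rewrite ag2 // ag1.
    have r72 : regs s2 7 = i by rewrite ag2.
    have [hmul hdiv [_ hmulp] hdist _] := tabs _ _ K2.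
    pose u : T := Ordinal hj.
    have uE : inord j = u by apply: val_inj; rewrite /= inordK.
    have dE : tab (memory s2) 4 (s * n + j) = dist e s u := hdist s u.
    apply: wp_ifeq; sim; rewrite f0 r52 r72 rj (mul_okT hmul) // dE.
      move=> di; rewrite /t2 uE di eqxx mul1n.
      pose I3 (l a b : nat) (m : nat -> nat) := K (lex i j l 0) m.
      pose t3 l := 990 + e u (inord l) * (P * (tb + 300) + 5).
      apply: (wp_mono (wp_for (I := I3) (tb := t3) _ _ _)) => //.
      * move=> l s3; rewrite f1 => hl ag3 rl K3.
        have G3 := globals_agree (isT : 5 <= 9) ag3 G2; have [h0 _ _ h3 _] := G3.
        have r53 : regs s3 5 = s by rewrite ag3.
        have r73 : regs s3 7 = i by rewrite ag3.
        have r83 : regs s3 8 = j by rewrite ag3.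
        have [hmul3 hdiv3 [_ hmulp3] hdist3 _] := tabs _ _ K3.
        pose w : T := Ordinal hl.
        have wE : inord l = w by apply: val_inj; rewrite /= inordK.
        (* A candidate that fails a test yields no shift, so the set of shifts to be handled does
           not grow. *)
        have skip : ~~ (e u w && (dist e s w == i.+1)) -> I3 l.+1 (regs s3 10) (regs s3 11) (memory s3).
          move=> nt; apply: Kmono K3 => q y [qN tr]; rewrite /lex ltn0 andbF orbF ltnS (leq_eqVlt y) => h.
          split => //; case/orP: h => [->//|/andP [lq h]]; rewrite lq; apply/orP; right => /=.
          case/orP: h => [->//|/andP [uq h]]; rewrite uq; apply/orP; right => /=.
          case/orP: h => [yw|->//].
          have qu : top q = u by apply: val_inj; rewrite /= topE //; apply/eqP.
          have yw' : y = w by apply: val_inj; apply/eqP.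
          by move: tr nt; rewrite /trans qu yw' di => ->.
        have dE1 : tab (memory s3) 4 (j * n + l) = dist e u w := hdist3 u w.
        have dE2 : tab (memory s3) 4 (s * n + l) = dist e s w := hdist3 s w.
        apply: wp_ifeq; sim; rewrite h0 r83 rl (mul_okT hmul3) // dE1; last first.
          move=> ne t ht; split; first by rewrite /t3; lia.
            by [].
          by apply: skip; rewrite -(dist_edgeE e_irr e_conn); case: eqP.
        move=> /(dist1_edge e_conn) euw.
        apply: wp_ifeq; sim; rewrite h0 r53 r73 rl (mul_okT hmul3) // dE2 addn1; last first.
          move=> ne t ht; split; first by rewrite /t3; lia.
            by [].
          by apply: skip; apply/negP => /andP [_ /eqP].
        move=> dw.
        pose I4 (c a b : nat) (m : nat -> nat) := K (lex i j l c) m.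
        apply: (wp_mono (wp_for_const (I := I4) (tb := tb + 290) _ _ _)) => //.
          move=> c s4; rewrite h3 => hc ag4 rc K4.
          have G4 := globals_agree (isT : 5 <= 10) ag4 G3; have [k0 _ _ _ _] := G4.
          have r84 : regs s4 8 = j by rewrite ag4.
          have r94 : regs s4 9 = l by rewrite ag4.
          have [hmul4 hdiv4 [_ hmulp4] _ _] := tabs _ _ K4.
          pose q := j * P + c.
          have qN : q < N by rewrite NE; apply: index2_lt.
          have qu : top q = u.
            by apply: val_inj; rewrite /= topE // divnMDl // divn_small // addn0.
          have tr : trans g e s q w by rewrite /trans qu euw dw di eqxx.
          wps; sim; rewrite k0 r84 r94 rc !hmulp4 // -/q hdiv4 //.
          apply: (wp_mono (Kbody (lex i j l c) q w _ _ _ _ _ _ qN tr _)) => //=.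
          { move=> q' w' [q'N _ h]; split => //; have -> : lay q = i by rewrite /lay qu.
             by case/orP: h => [/ltnW//|/andP [/eqP -> _]]. }
          move=> s5 t5 [ht5 ag5 K5]; split; first by lia.
            by agr; rewrite ag5; [upd | lia].
          apply: Kmono K5 => q' w' [q'N tr']; rewrite /lex ltnS (leq_eqVlt (_ %% _)) => h.
          case/orP: h => [h|/andP [lq h]]; first by left; split => //; rewrite h.
          case/orP: h => [h|/andP [uq h]]; first by left; split => //; rewrite lq h !orbT.
          case/orP: h => [h|/andP [wq h]]; first by left; split => //; rewrite lq uq h !orbT.
          case/orP: h => [h|h]; last by left; split => //; rewrite lq uq wq h !orbT.
          right; split; last by apply: val_inj; apply/eqP.
          by rewrite (divn_eq q' P) (eqP uq) (eqP h).
        move=> s4 t4; rewrite h3 => -[ht4 ag4 K4]; split; first by rewrite /t3 wE euw; lia.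
          exact: agreeW ag4.
        apply: Kmono K4 => q' w' [q'N tr']; rewrite /lex ltn0 andbF orbF ltnS (leq_eqVlt w') => h.
        by split => //; rewrite ltn_mod P0 andbT (orbC (w' < l)).
      * move=> s3 t3'; rewrite f1 => -[ht3 ag3 K3]; split.
        -- have -> : X j = n * 1000 + \sum_(0 <= w < n) (e u (inord w) : nat) * (P * (tb + 300) + 5).
             by rewrite /X /outdeg uE -(sum_edge u) big_distrl.
           move: ht3; rewrite /t3.
           rewrite (eq_bigr (fun l => 997 + e u (inord l) * (P * (tb + 300) + 5))); last by move=> l _; lia.
           by rewrite big_split /= sum_nat_const_nat subn0; lia.
        -- exact: agreeW ag3.
        apply: Kmono K3 => q' w' [q'N tr']; rewrite /lex !ltn0 !andbF orbF ltnS (leq_eqVlt (_ %/ _)) => h.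
        by split => //; rewrite ltn_ord /= andbT (orbC (q' %/ _ < j)).
    move=> ne t ht; split; first by rewrite /t2; lia.
      by [].
    apply: Kmono K2 => q' w' [q'N tr']; rewrite /lex !ltn0 !andbF !orbF ltnS (leq_eqVlt (_ %/ _)) => h.
    split => //; case/orP: h => [->//|/andP [lq /orP [uq|->]]]; last by rewrite lq orbT.
    exfalso; apply: ne; rewrite -(eqP lq) /lay; congr dist; apply: val_inj.
    by rewrite /= topE //; apply/esym/eqP.
  + move=> s2 t2'; rewrite e1 => -[ht2 ag2 K2]; split.
    * move: ht2; rewrite /t1 /t2.
      rewrite (eq_bigr (fun j => 520 + (dist e s (inord j) == i) * X j)); last by move=> l _; lia.
      by rewrite big_split /= sum_nat_const_nat subn0; lia.
    * exact: agreeW ag2.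
    apply: Kmono K2 => q' w' [q'N tr']; rewrite /lex !ltn0 !andbF !orbF ltnS (leq_eqVlt (lay _)) => h.
    by split => //; rewrite ltn_divLR // -NE q'N /= andbT (orbC (lay q' < i)).
- move=> s1 t1'; rewrite g1 => -[ht1 ag1 K1]; split => //.
  + apply: leq_trans ht1 _; rewrite /t1.
    rewrite (eq_bigr (fun i => (n * 520 + 12) + \sum_(0 <= j < n) (dist e s (inord j) == i) * X j)); last by move=> l _; lia.
    rewrite big_split /= sum_nat_const_nat subn0 exchange_big /=.
    (* After exchanging the sums, each [X j] is counted for at most one layer. *)
    have h : \sum_(0 <= j < n) \sum_(0 <= i < n) (dist e s (inord j) == i) * X j <= \sum_(0 <= j < n) X j.
      apply: leq_sum => j _; rewrite -big_distrl /= -{2}(mul1n (X j)) leq_mul2r; apply/orP; right.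
      by rewrite sum_eq; case: (_ < _).
    have hX : \sum_(0 <= j < n) X j = n * (n * 1000) + degsum nb * (P * (tb + 300) + 5).
      by rewrite /X big_split /= sum_nat_const_nat subn0 -big_distrl.
    rewrite hX in h; lia.
  + apply: Kmono K1 => q w [qN tr]; split => //.
    have -> : lay q < n by rewrite /lay; have := dist_lt_card (e_conn s (top q)); rewrite card_ord.
    by [].
Qed.

End Source.
End Main.

(** * The bodies of the two passes, and the pass computing least distances *)

Definition Min (r r' : nat) : prog := If (Reg r') (Reg r) (Assign r (Reg r')) Skip.
Definition Max (r r' : nat) : prog := If (Reg r) (Reg r') (Assign r (Reg r')) Skip.

(** The resulting registers are described only by their values, which merges the two branches and
    lets a proof continue once. *)
Lemma wp_min r r' s (Q : state -> nat -> Prop) :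
  (forall f t, t <= 5 -> (forall k, k != r -> f k = regs s k) ->
    f r = minn (regs s r) (regs s r') -> Q (State f (memory s)) t) ->
  wp (Min r r') s Q.
Proof.
case: s => f m H; apply: wp_if => /= h; wps; apply: H => //=.
- by move=> k hk; rewrite update_neq.
- by rewrite updateE eqxx; symmetry; apply/minn_idPr; rewrite ltnW.
- by symmetry; apply/minn_idPl.
Qed.

Lemma wp_max r r' s (Q : state -> nat -> Prop) :
  (forall f t, t <= 5 -> (forall k, k != r -> f k = regs s k) ->
    f r = maxn (regs s r) (regs s r') -> Q (State f (memory s)) t) ->
  wp (Max r r') s Q.
Proof.
case: s => f m H; apply: wp_if => /= h; wps; apply: H => //=.
- by move=> k hk; rewrite update_neq.
- by rewrite updateE eqxx; symmetry; apply/maxn_idPr; rewrite ltnW.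
- by symmetry; apply/maxn_idPl.
Qed.

Definition relax_reach : prog :=
  For 13 1
    (Seq (Assign 14 (Get 6 (Add (Get 0 (Reg 11)) (Reg 13))))
    (If (Reg 14) (Reg 1)
      (Seq (Assign 15 (Get 4 (Add (Get 0 (Reg 9)) (Reg 13))))
      (Seq (Min 14 15)
      (Seq (Assign 16 (Add (Get 0 (Reg 12)) (Reg 13)))
           (If (Reg 14) (Get 6 (Reg 16)) (Put 6 (Reg 16) (Reg 14)) Skip))))
      Skip)).

Definition get_charge : prog :=
  For 13 1
    (Seq (Assign 15 (Add (Get 0 (Reg 12)) (Reg 13)))
    (If (Get 6 (Reg 15)) (Get 5 (Reg 15))
      (Seq (Assign 15 (Add (Get 0 (Reg 11)) (Reg 13)))
      (If (Get 6 (Reg 15)) (Get 5 (Reg 15)) Skip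
        (Seq (Assign 15 (Get 5 (Reg 15)))
        (Seq (Assign 16 (Get 4 (Add (Get 0 (Reg 9)) (Reg 13))))
        (Seq (Min 15 16) (Max 14 15))))))
      Skip)).

(** No test for infinity is needed: if the cost at the source window is [n], the candidate is at
    least [n] and never falls below an entry, which is at most [n]. *)
Definition relax_cost : prog :=
  Seq (Assign 14 (Const 0))
 (Seq get_charge
 (Seq (Assign 15 (Get 7 (Reg 11)))
 (Seq (Max 14 15)
      (If (Reg 14) (Get 7 (Reg 12))
        (Seq (Put 7 (Reg 12) (Reg 14)) (Put 8 (Reg 12) (Reg 11)))
        Skip)))).

Lemma bigmax_ltS n (A : pred 'I_n) (F : 'I_n -> nat) (y : 'I_n) :
  \max_(x < n | A x && (x < y.+1)) F x =
  maxn (\max_(x < n | A x && (x < y)) F x) (if A y then F y else 0).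
Proof.
case: ifP => Ay; last first.
  rewrite maxn0; apply: eq_bigl => x; rewrite ltnS (leq_eqVlt x).
  case: eqP => //= xy; have -> : x = y by apply: val_inj.
  by rewrite Ay.
rewrite (bigD1 y) ?Ay ?ltnSn //= maxnC; congr maxn; apply: eq_bigl => x.
by rewrite -andbA; congr andb; rewrite ltnS (ltn_neqAle x) andbC.
Qed.

Section Passes.

Variables (n' g B : nat) (e : rel 'I_n'.+1) (nb : 'I_n'.+1 -> seq 'I_n'.+1).
Local Notation n := n'.+1.
Local Notation T := 'I_n.
Local Notation N := (n ^ g.+1).
Local Notation P := (n ^ g).
Local Notation tab := (tab B).
Local Notation frame := (frame B).
Local Notation globals := (globals n' g B).
Local Notation step := (step n' g).
Local Notation top := (top n' g).
Local Notation code := (code n' g).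
Local Notation start := (start n' g).
Local Notation tables_ok := (tables_ok g B e).
Local Notation mtab := (mtab (n' := n') B).

Hypotheses (e_sym : symmetric e) (e_irr : irreflexive e)
  (e_conn : forall u v, connect e u v) (nbP : adjacency_lists e nb).

Lemma relax_reach_spec st q (w : T) :
  globals st -> tables_ok (memory st) -> regs st 9 = w -> regs st 11 = q ->
  regs st 12 = step q w -> q < N -> q <> step q w ->
  wp relax_reach st (fun st' t => [/\ t <= n * 600 + 5, agree 13 st st',
    frame [:: 6] (memory st) (memory st') &
    forall a x, mtab (memory st') a x =
      if (a == step q w) && (mtab (memory st) q x < n) then
        minn (mtab (memory st) a x) (minn (mtab (memory st) q x) (dist e w x))
      else mtab (memory st) a x]).
Proof.
move=> G tok r9 r11 r12 qN nq; have [g0 g1 g2 g3 g4] := G; rewrite /relax_reach.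
set m0 := memory st; set q' := step q w in r12 nq *.
have q'N : q' < N by apply: step_lt.
pose new a x := if (a == q') && (mtab m0 q x < n) then
  minn (mtab m0 a x) (minn (mtab m0 q x) (dist e w x)) else mtab m0 a x.
pose I1 (c i j : nat) (m : nat -> nat) := frame [:: 6] m0 m /\
  forall a (x : T), mtab m a x = if x < c then new a x else mtab m0 a x.
apply: (wp_mono (wp_for_const (I := I1) (tb := 590) _ _ _)) => //.
  move=> c s1; rewrite g1 => hc ag1 rc [fr h].
  have [e0 e1 _ _ _] := globals_agree (isT : 5 <= 13) ag1 G.
  have [hmul _ _ hdist _] : tables_ok (memory s1) by apply: (tables_frame6 _ fr).
  pose x : T := Ordinal hc.
  have a9 : regs s1 9 = w by rewrite ag1.
  have a11 : regs s1 11 = q by rewrite ag1.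
  have a12 : regs s1 12 = q' by rewrite ag1.
  have mq : tab (memory s1) 6 (q * n + c) = mtab m0 q x by rewrite -[LHS]/(mtab _ q x) h ltnn.
  have mq' : tab (memory s1) 6 (q' * n + c) = mtab m0 q' x by rewrite -[LHS]/(mtab _ q' x) h ltnn.
  have dw : tab (memory s1) 4 (w * n + c) = dist e w x := hdist w x.
  have done_ m : frame [:: 6] (memory s1) m ->
    (forall a y, mtab m a y = if (a == q') && (y == x) then new q' x else mtab (memory s1) a y) ->
    frame [:: 6] m0 m /\ forall a (y : T), mtab m a y = if y < c.+1 then new a y else mtab m0 a y.
    move=> fr' hm; split; first exact: frame_trans fr fr'.
    move=> a y; rewrite hm h ltnS (leq_eqVlt y) -[y == c :> nat]/(y == x).
    case: (a =P q') => [->|/eqP na] /=; first by case: (y =P x) => [-> //|_].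
    by rewrite /new (negbTE na) /= !if_same.
  wps; sim; rewrite e0 a11 rc hmul // mq.
  apply: wp_if; sim; rewrite e1 => hlt; wps; sim; last first.
    split; [lia | by agr |]; apply: done_ => // a y.
    case: ifP => // /andP [/eqP -> /eqP ->].
    by rewrite h ltnn /new ltnNge hlt andbF.
  apply: wp_min => f t ht hf; sim; rewrite rc a9 e0 (mul_okT hmul) // dw => fE.
  have f0 : f 0 = B by rewrite hf.
  have f13 : f 13 = c by rewrite hf.
  have f12 : f 12 = q' by rewrite hf.
  wps; sim; rewrite f0 f13 f12 hmul //.
  have newE : new q' x = minn (mtab m0 q' x) (f 14) by rewrite /new eqxx hlt fE.
  apply: wp_if; sim; rewrite f0 mq' => hlt2; wps; sim.
    split; [lia | by agr; rewrite hf; [upd | rewrite neq_ltn; lia] |].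
    apply: done_; rewrite ?f0; first exact: frame_put.
    move=> a y; rewrite /mtab tab_put //= index2_eq // -[y == c :> nat]/(y == x).
    by rewrite newE (minn_idPr _) // ltnW.
  split; [lia | by agr; rewrite hf; [upd | rewrite neq_ltn; lia] |].
  apply: done_ => // a y; case: ifP => // /andP [/eqP -> /eqP ->].
  by rewrite h ltnn newE (minn_idPl _).
move=> s1 t1; rewrite g1 => -[ht1 ag1 [fr h]]; split => //; first lia.
by move=> a x; rewrite h ltn_ord.
Qed.

Section Source.

Variable s : T.

(** Every finite entry is realised by a path with that window, which gives [M_attained]. The closure
    under handled shifts gives [M_le] by induction along a path once all shifts are handled. *)
Definition reach_inv m0 (S : nat -> T -> Prop) m :=
  [/\ frame [:: 6] m0 m,
   forall q x, q < N -> mtab m q x < n ->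
     exists R, [/\ rpath e s R, code s R = q & mind e R x <= mtab m q x],
   forall x, mtab m (start s) x <= dist e s x &
   forall q w x, S q w -> mtab m q x < n ->
     mtab m (step q w) x <= minn (mtab m q x) (dist e w x)].

Lemma trans_layer q (w : T) : q < N -> trans g e s q w -> lay g e s (step q w) = (lay g e s q).+1.
Proof. by move=> qN /andP [_ /eqP <-]; rewrite /lay top_step. Qed.

Lemma trans_neq q (w : T) : q < N -> trans g e s q w -> q <> step q w.
Proof. by move=> qN tr h; have := trans_layer qN tr; rewrite -h; lia. Qed.

Lemma rpath_trans R (w : T) : rpath e s R -> trans g e s (code s R) w -> rpath e s (w :: R).
Proof.
case: R => [|u R] H; first by inversion H.
by rewrite /trans top_code => /andP [eu /eqP du]; constructor.
Qed.

Lemma reach_spec st :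
  globals st -> tables_ok (memory st) -> regs st 5 = s ->
  (forall q, q < N -> forall x, mtab (memory st) q x = if q == start s then dist e s x else n) ->
  wp (for_trans relax_reach) st (fun st' t =>
    [/\ t <= n * (n * 1600 + 12) + 5 + degsum nb * (P * (n * 600 + 305) + 5), agree 7 st st',
      frame [:: 6] (memory st) (memory st'),
      forall R x, rpath e s R -> mtab (memory st') (code s R) x <= mind e R x &
      forall R x, rpath e s R -> exists R',
        [/\ rpath e s R', code s R' = code s R & mind e R' x <= mtab (memory st') (code s R) x]]).
Proof.
move=> G tok r5 hini.
have sN : start s < N by rewrite start_iter_lt.
apply: (wp_mono (for_trans_spec (s := s) (nb := nb) (K := reach_inv (memory st))
  (tb := n * 600 + 5) e_irr e_conn nbP G tok r5 _ _ _ _)).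
- by move=> S m [fr _ _ _]; apply: frameW fr.
- by move=> S S' m hS [h1 h2 h3 h4]; split => // q w x /hS; apply: h4.
- move=> S q w st' G' r9 r11 r12 [fr snd ini sat] qN tr hS.
  have tok' : tables_ok (memory st') by apply: (tables_frame6 _ fr).
  have nq := trans_neq qN tr.
  apply: (wp_mono (relax_reach_spec G' tok' r9 r11 r12 qN nq)) => st'' t [ht ag fr' hm].
  have dec a x : mtab (memory st'') a x <= mtab (memory st') a x.
    by rewrite hm; case: ifP => // _; rewrite geq_minl.
  have keep a x : a <> step q w -> mtab (memory st'') a x = mtab (memory st') a x.
    by move=> na; rewrite hm; case: eqP.
  split => //; split.
  + exact: frame_trans fr fr'.
  + move=> a x aN; rewrite hm; case: ifP => [/andP [/eqP -> hq] _|_]; last exact: snd.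
    set v := minn (mtab (memory st') q x) _.
    case: (leqP (mtab (memory st') (step q w) x) v) => h.
      have [|R [H cR hR]] := snd (step q w) x (step_lt (ltn_ord w) qN).
        by apply: leq_ltn_trans h _; rewrite gtn_min hq.
      by exists R.
    have [R [H cR hR]] := snd q x qN hq.
    exists (w :: R); split; first by apply: rpath_trans => //; rewrite cR.
      by rewrite /= -/(code s R) cR.
    by rewrite /= minnC leq_min !geq_min hR leqnn !orbT.
  + by move=> x; apply: leq_trans (dec _ _) (ini x).
  + move=> a b x [Sab|[-> ->]].
      have [aN la] := hS a b Sab.
      (* The handled shift starts at [a], in a layer up to that of [q], whereas [step q w] lies one
         layer beyond [q]; so row [a] is unchanged. *)
      rewrite keep; last by move=> h; move: la; rewrite h trans_layer // ltnn.
      by move=> ha; apply: leq_trans (dec _ _) (sat _ _ _ Sab ha).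
    rewrite keep // => hq; rewrite hm eqxx hq /=; exact: geq_minr.
- split => //.
  + move=> q x qN; rewrite hini //; case: eqP => [->|_]; last by rewrite ltnn.
    move=> _; exists [:: s]; split => //; first by constructor.
    exact: geq_minl.
  + by move=> x; rewrite hini // eqxx.
- move=> st' t [ht ag [fr snd ini sat]].
  have le R x : rpath e s R -> mtab (memory st') (code s R) x <= mind e R x.
    elim: R => [|w R IH] H; first by inversion H.
    case: R IH H => [|u R] IH H.
      have ws := rpath_inv1 H; subst w; rewrite code1 /= leq_min ini /=.
      by rewrite card_ord (leq_trans (ini x)) //; have := dist_lt_card (e_conn s x); rewrite card_ord; apply: ltnW.
    have [HR eu du] := rpath_inv H; have hR := IH HR.
    rewrite [code s _]/= -/(code s (u :: R)).
    have hlt : mtab (memory st') (code s (u :: R)) x < n.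
      apply: leq_ltn_trans hR _.
      by have := mind_lt_card e_conn x (rpath_src HR); rewrite card_ord.
    apply: leq_trans (sat _ _ _ _ hlt) _.
      by split; [exact: code_lt | rewrite /trans top_code eu du eqxx].
    by rewrite /= minnC leq_min geq_minl /= -/(mind e (u :: R) x) (leq_trans (geq_minr _ _)).
  split => //; first by lia.
  move=> R x H; apply: snd; first exact: code_lt.
  apply: leq_ltn_trans (le R x H) _.
  by have := mind_lt_card e_conn x (rpath_src H); rewrite card_ord.
Qed.

End Source.
End Passes.

(** * The pass computing least costs, and the choice of the best final window *)

Definition output : prog :=
  Seq (Assign 11 (Add (Get 4 (Add (Get 0 (Reg 5)) (Get 2 (Reg 7)))) (Const 1)))
 (Seq (Store (Const 0) (Reg 11))
 (Seq (Assign 13 (Reg 7))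
      (For 12 11 (Seq (Store (Defs.Sub (Reg 11) (Reg 12)) (Get 2 (Reg 13)))
                      (Assign 13 (Get 8 (Reg 13))))))).

Definition get_rest : prog :=
  For 9 1
    (Seq (Assign 11 (Add (Get 0 (Reg 7)) (Reg 9)))
    (If (Get 6 (Reg 11)) (Get 5 (Reg 11)) Skip
      (Seq (Assign 11 (Get 5 (Reg 11))) (Max 10 11)))).

(** The path is written anew at each improvement. This takes time [O(n)], as does [get_rest], so it
    does not raise the order of the time per window. *)
Definition select : prog :=
  For 7 4
    (If (Get 7 (Reg 7)) (Reg 1)
      (Seq (Assign 10 (Get 7 (Reg 7)))
      (Seq get_rest
           (If (Reg 10) (Reg 8) (Seq (Assign 8 (Reg 10)) output) Skip)))
      Skip).

Section Passes.

Variables (n' g B : nat) (e : rel 'I_n'.+1) (nb : 'I_n'.+1 -> seq 'I_n'.+1).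
Local Notation n := n'.+1.
Local Notation T := 'I_n.
Local Notation N := (n ^ g.+1).
Local Notation P := (n ^ g).
Local Notation tab := (tab B).
Local Notation frame := (frame B).
Local Notation globals := (globals n' g B).
Local Notation step := (step n' g).
Local Notation top := (top n' g).
Local Notation code := (code n' g).
Local Notation start := (start n' g).
Local Notation tables_ok := (tables_ok g B e).
Local Notation mtab := (mtab (n' := n') B).

Hypotheses (e_sym : symmetric e) (e_irr : irreflexive e)
  (e_conn : forall u v, connect e u v) (nbP : adjacency_lists e nb).

Lemma get_charge_spec st q (w : T) (M : nat -> T -> nat) :
  globals st -> tables_ok (memory st) -> regs st 9 = w -> regs st 11 = q ->
  regs st 12 = step q w -> regs st 14 = 0 -> q < N ->
  (forall a x, mtab (memory st) a x = M a x) ->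
  wp get_charge st (fun st' t => [/\ t <= n * 500 + 5, agree 13 st st',
    memory st' = memory st & regs st' 14 = charge g e M q w]).
Proof.
move=> G tok r9 r11 r12 r14 qN hM; have [g0 g1 g2 g3 g4] := G; rewrite /get_charge.
set q' := step q w in r12 *; have q'N : q' < N by apply: step_lt.
pose A x := decided g e M q' x && ~~ decided g e M q x.
pose F x := minn (wdist g e q x) (dist e w x).
have [hmul _ _ hdist hwd] := tok.
pose I1 (c a b : nat) (m : nat -> nat) := m = memory st /\
  a = \max_(x < n | A x && (x < c)) F x.
apply: (wp_mono (wp_for_const (I := I1) (tb := 490) _ _ _)) => //.
- by split => //; rewrite r14 big_pred0 // => x; rewrite ltn0 andbF.
- move=> c s1; rewrite g1 => hc ag1 rc [hm ha].
  have [e0 e1 _ _ _] := globals_agree (isT : 5 <= 13) ag1 G.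
  pose x : T := Ordinal hc.
  have a9 : regs s1 9 = w by rewrite ag1.
  have a11 : regs s1 11 = q by rewrite ag1.
  have a12 : regs s1 12 = q' by rewrite ag1.
  have mq : tab (memory st) 6 (q * n + c) = M q x := hM q x.
  have mq' : tab (memory st) 6 (q' * n + c) = M q' x := hM q' x.
  have wq : tab (memory st) 5 (q * n + c) = wdist g e q x := hwd q x qN.
  have wq' : tab (memory st) 5 (q' * n + c) = wdist g e q' x := hwd q' x q'N.
  have dw : tab (memory st) 4 (w * n + c) = dist e w x := hdist w x.
  have skip : ~~ A x -> I1 c.+1 (regs s1 14) 0 (memory s1).
    by move=> nA; split => //; rewrite (bigmax_ltS A F x) (negbTE nA) maxn0.
  wps; sim; rewrite e0 a12 rc hm hmul //.
  apply: wp_if; sim; rewrite ?e0 ?hm mq' wq' => h1; wps; sim; rewrite ?e0 ?hm; last first.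
    split; [lia | by agr |].
    by have := skip; rewrite /A /decided ltnNge h1 => /(_ isT); rewrite hm.
  rewrite a11 rc hmul //; apply: wp_if; sim; rewrite ?e0 ?hm mq wq => h2; wps; sim; rewrite ?e0 ?hm.
    split; [lia | by agr |].
    by have := skip; rewrite /A /decided h2 andbF => /(_ isT); rewrite hm.
  rewrite wq a9 rc (mul_okT hmul) // dw.
  apply: wp_min => f t ht hf /=; rewrite !updateE /= => fE.
  apply: wp_max => f' t' ht' hf' /= fE'; split; first lia.
    by agr; rewrite hf'; [rewrite /= hf; [upd|] |]; rewrite ?neq_ltn; lia.
  split => //; rewrite (bigmax_ltS A F x) fE' fE hf //= !updateE /= ha.
  by rewrite /A /decided h1 -leqNgt h2.
- move=> s1 t1; rewrite g1 => -[ht1 ag1 [hm ha]]; split => //; first lia.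
  by rewrite ha; apply: eq_bigl => x; rewrite ltn_ord andbT.
Qed.

Lemma relax_cost_spec st q (w : T) (M : nat -> T -> nat) :
  globals st -> tables_ok (memory st) -> regs st 9 = w -> regs st 11 = q ->
  regs st 12 = step q w -> q < N ->
  (forall a x, mtab (memory st) a x = M a x) ->
  let v := maxn (tab (memory st) 7 q) (charge g e M q w) in
  let c := v < tab (memory st) 7 (step q w) in
  wp relax_cost st (fun st' t => [/\ t <= n * 500 + 200, agree 13 st st',
    frame [:: 7; 8] (memory st) (memory st'),
    forall a, tab (memory st') 7 a = if (a == step q w) && c then v else tab (memory st) 7 a &
    forall a, tab (memory st') 8 a = if (a == step q w) && c then q else tab (memory st) 8 a]).
Proof.
move=> G tok r9 r11 r12 qN hM v c; have [g0 g1 g2 g3 g4] := G; rewrite /relax_cost; wps; sim.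
set q' := step q w in r12 c *.
have G' : globals (State (update (regs st) 14 0) (memory st)) by apply: globals_upd.
apply: (wp_mono (get_charge_spec (w := w) G' tok _ _ _ _ qN hM)) => //=.
move=> s1 t1 [ht1 ag1 hm hc].
have [e0 _ _ _ _] := globals_agree (isT : 5 <= 13) ag1 G'.
have a11 : regs s1 11 = q by rewrite ag1.
have a12 : regs s1 12 = q' by rewrite ag1.
wps; sim; apply: wp_max => f t ht hf /=; rewrite !updateE /= e0 hm a11 hc => fE.
have fv : f 14 = v by rewrite fE maxnC.
have f0 : f 0 = B by rewrite hf.
have f11 : f 11 = q by rewrite hf.
have f12 : f 12 = q' by rewrite hf.
have fag : agree 13 st (State f (memory st)).
  by agr; rewrite hf; [upd; rewrite ag1; [upd | lia] | rewrite neq_ltn; lia].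
apply: wp_if; sim; rewrite fv f0 f12 -/c => h; wps; sim; rewrite ?f0 ?f12 ?fv ?f11.
  have -> : c = true := h.
  split; first lia.
  - exact: fag.
  - by apply: (@frame_trans _ _ _ (tput B (memory st) 7 q' v)); apply: frame_put.
  - by move=> a; rewrite !tab_put //= andbT.
  - by move=> a; rewrite !tab_put //= andbT.
have -> : c = false by apply/negbTE; rewrite /c -leqNgt.
by split => //; [lia | move=> a; rewrite andbF | move=> a; rewrite andbF].
Qed.

Section Source.

Variable s : T.

(** The clause on [par] is an inequality, so a decrease of the cost at a predecessor preserves
    it. *)
Definition cost_inv (M : nat -> T -> nat) m0 (S : nat -> T -> Prop) m :=
  let D := tab m 7 in let par := tab m 8 in
  [/\ frame [:: 7; 8] m0 m, forall q, q < N -> D q <= n, D (start s) = 0,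
   forall q w, S q w -> D q < n -> D (step q w) <= maxn (D q) (charge g e M q w) &
   forall q, q < N -> D q < n -> q <> start s -> exists w, [/\ par q < N, D (par q) < n,
     trans g e s (par q) w, q = step (par q) w & maxn (D (par q)) (charge g e M (par q) w) <= D q]].

Lemma cost_spec st (M : nat -> T -> nat) :
  globals st -> tables_ok (memory st) -> regs st 5 = s ->
  (forall a x, mtab (memory st) a x = M a x) ->
  (forall q, q < N -> tab (memory st) 7 q = if q == start s then 0 else n) ->
  wp (for_trans relax_cost) st (fun st' t =>
    [/\ t <= n * (n * 1600 + 12) + 5 + degsum nb * (P * (n * 500 + 500) + 5), agree 7 st st' &
     cost_inv M (memory st) (fun q w => q < N /\ trans g e s q w) (memory st')]).
Proof.
move=> G tok r5 hM hini.
have sN : start s < N by rewrite start_iter_lt.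
apply: (wp_mono (for_trans_spec (s := s) (nb := nb) (K := cost_inv M (memory st))
  (tb := n * 500 + 200) e_irr e_conn nbP G tok r5 _ _ _ _)).
- by move=> S m [fr _ _ _ _]; apply: frameW fr.
- by move=> S S' m hS [h1 h2 h3 h4 h5]; split => // q w /hS; apply: h4.
- move=> S q w st' G' r9 r11 r12 [fr Dn D0 sat hpar] qN tr hS.
  have tok' : tables_ok (memory st') by apply: (tables_frame6 _ fr).
  have hM' a x : mtab (memory st') a x = M a x by rewrite /mtab (fr.2) // -hM.
  have nq := trans_neq qN tr.
  apply: (wp_mono (relax_cost_spec G' tok' r9 r11 r12 qN hM')) => st'' t.
  set q' := step q w in r12 nq *.
  have q'N : q' < N by apply: step_lt.
  set v := maxn _ _; set c := v < _ => -[ht ag fr' hD hP].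
  have dec a : tab (memory st'') 7 a <= tab (memory st') 7 a.
    by rewrite hD; case: ifP => // /andP [/eqP -> hc]; apply: ltnW.
  have keep a : a <> q' -> tab (memory st'') 7 a = tab (memory st') 7 a.
    by move=> na; rewrite hD; case: eqP.
  split => //; split.
  + exact: frame_trans fr fr'.
  + by move=> a aN; apply: leq_trans (dec a) (Dn a aN).
  + by apply/eqP; rewrite -leqn0; apply: leq_trans (dec _) _; rewrite D0.
  + move=> a b [Sab|[-> ->]].
      have [aN la] := hS a b Sab.
      rewrite keep; last by move=> h; move: la; rewrite h trans_layer // ltnn.
      by move=> ha; apply: leq_trans (dec _) (sat _ _ Sab ha).
    rewrite keep // => hq; rewrite -/v -/q' hD eqxx /=; case: ifP => // /negbT.
    by rewrite -leqNgt.
  + move=> a aN; case: (a =P q') => [->|na].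
      rewrite hD hP eqxx /=; case: (boolP c) => _; first move=> hv _.
        exists w; split => //; rewrite keep //; apply: leq_ltn_trans hv; exact: leq_maxl.
      move=> hD' ns; have [b [b1 b2 b3 b4 b5]] := hpar q' q'N hD' ns.
      exists b; split => //; first by apply: leq_ltn_trans (dec _) b2.
      by apply: leq_trans b5; rewrite geq_max !leq_max dec leqnn orbT.
    rewrite hD hP; case: eqP => //= _ hD' ns.
    have [b [b1 b2 b3 b4 b5]] := hpar a aN hD' ns.
    exists b; split => //; first by apply: leq_ltn_trans (dec _) b2.
    by apply: leq_trans b5; rewrite geq_max !leq_max dec leqnn orbT.
- split => //.
  + by move=> q qN; rewrite hini //; case: eqP.
  + by rewrite hini // eqxx.
  + by move=> q qN; rewrite hini //; case: eqP => // _; rewrite ltnn.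
- by move=> st' t [ht ag inv]; split => //; lia.
Qed.

(** Vacuous for the initial value [best = n]. The source is existential because the stored path may
    stem from an earlier round of the main loop. *)
Definition out_ok (best : nat) (m : nat -> nat) : Prop :=
  best < n -> exists s' (R : seq T), [/\ rpath e s' R, ecc e [set u in R] <= best, m 0 = size R &
    forall i, i < size R -> m (size R - i) = nth ord0 R i].

Lemma out_frame js best m m' : 3 + n < B -> frame js m m' -> out_ok best m -> out_ok best m'.
Proof.
move=> hB [fr _] h /h [s' [R [H hR h0 hi]]]; exists s', R.
have sR : size R <= n.
  case: R H {hR h0 hi} => // w R /rpath_dist dw /=; rewrite -dw.
  by have := dist_lt_card (e_conn s' w); rewrite card_ord.
by split => //; [rewrite fr // ; lia | move=> i hi'; rewrite fr ?hi //; lia].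
Qed.

Definition same_tabs (m m' : nat -> nat) : Prop := forall j i, tab m' j i = tab m j i.

Lemma tab_low m a v j i : a < B -> tab (update m a v) j i = tab m j i.
Proof. by move=> ha; rewrite /tab update_neq // neq_ltn; lia. Qed.

Section Select.

Variables (M : nat -> T -> nat) (D par : nat -> nat).
Hypothesis D_attained : forall q, q < N -> D q < n ->
  exists R, [/\ rpath e s R, code s R = q, pcost g e M s R <= D q &
    forall i, i < size R -> iter i par q = code s (drop i R)].
Hypothesis ecc_val : forall R, rpath e s R ->
  ecc e [set u in R] = maxn (pcost g e M s R) (rest g e M (code s R)).

Definition select_tabs (m : nat -> nat) : Prop :=
  [/\ tables_ok m, forall q, tab m 7 q = D q, forall q, tab m 8 q = par q &
      forall q x, mtab m q x = M q x].

Lemma select_same m m' : same_tabs m m' -> select_tabs m -> select_tabs m'.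
Proof.
move=> h [h1 h2 h3 h4]; split=> [|q|q|q x]; rewrite ?/mtab ?h //; last exact: h4.
by apply: (tables_frame (js := [::])) h1 => // j i _ _; apply: h.
Qed.

Lemma get_rest_spec st q :
  globals st -> select_tabs (memory st) -> regs st 7 = q -> q < N ->
  regs st 10 = D q ->
  wp get_rest st (fun st' t => [/\ t <= n * 140 + 5, agree 9 st st',
    memory st' = memory st & regs st' 10 = maxn (D q) (rest g e M q)]).
Proof.
move=> G [[hmul _ _ _ hwd] _ _ hM] r7 qN r10; have [g0 g1 g2 g3 g4] := G; rewrite /get_rest.
pose A x := ~~ decided g e M q x.
pose I1 (c a b : nat) (m : nat -> nat) := m = memory st /\
  a = maxn (D q) (\max_(x < n | A x && (x < c)) wdist g e q x).
apply: (wp_mono (wp_for_const (I := I1) (tb := 130) _ _ _)) => //.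
- by split => //; rewrite r10 big_pred0 ?maxn0 // => x; rewrite ltn0 andbF.
- move=> c s1; rewrite g1 => hc ag1 rc [hm ha].
  have [e0 e1 _ _ _] := globals_agree (isT : 5 <= 9) ag1 G.
  pose x : T := Ordinal hc.
  have a7 : regs s1 7 = q by rewrite ag1.
  have mq : tab (memory st) 6 (q * n + c) = M q x := hM q x.
  have wq : tab (memory st) 5 (q * n + c) = wdist g e q x := hwd q x qN.
  wps; sim; rewrite e0 a7 rc hm hmul //.
  apply: wp_if; sim; rewrite ?e0 ?hm mq wq => h1; wps; sim; rewrite ?e0 ?hm.
    split; [lia | by agr |]; split => //.
    by rewrite (bigmax_ltS A _ x) /A /decided h1 maxn0.
  rewrite wq; apply: wp_max => f t ht hf /= fE; split; first lia.
    by agr; rewrite hf; [upd | rewrite neq_ltn; lia].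
  split => //; rewrite (bigmax_ltS A _ x) fE !updateE /= ha /A /decided -leqNgt h1.
  by rewrite maxnA.
- move=> s1 t1; rewrite g1 => -[ht1 ag1 [hm ha]]; split => //; first lia.
  by rewrite ha; congr maxn; apply: eq_bigl => x; rewrite ltn_ord andbT.
Qed.

(** Storing entry [i] at address [size R - i] turns the backward list into the path read from its
    source. Only cells up to [n] are overwritten; they belong to the input, and from here on only
    registers and tables are read. *)
Lemma output_spec st q (R : seq T) :
  globals st -> select_tabs (memory st) -> 3 + n < B -> regs st 7 = q -> regs st 5 = s ->
  rpath e s R -> code s R = q -> (forall i, i < size R -> iter i par q = code s (drop i R)) ->
  wp output st (fun st' t => [/\ t <= n * 70 + 500, agree 9 st st',
    same_tabs (memory st) (memory st'), memory st' 0 = size R &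
    forall i, i < size R -> memory st' (size R - i) = nth ord0 R i]).
Proof.
move=> G stab hB r7 r5 HR cR hit; have [g0 g1 g2 g3 g4] := G; rewrite /output; wps; sim.
have P0 : 0 < P by rewrite expn_gt0.
have topE q' : q' < N -> (top q' : nat) = q' %/ P.
  by move=> hq; rewrite /top inordK // ltn_divLR // -expnS.
have qN : q < N by rewrite -cR code_lt.
have [[hmul _ [htop _] hdist _] hD hpar hM] := stab.
have sRE : dist e s (top q) + 1 = size R.
  case: (R) HR cR => [|u R'] HR' cR'; first by inversion HR'.
  by rewrite -cR' top_code (rpath_dist HR') addn1.
have sRn : size R <= n.
  by rewrite -sRE addn1; have := dist_lt_card (e_conn s (top q)); rewrite card_ord.
rewrite g0 r7 r5 htop // (mul_okT hmul) // -topE //.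
have -> : tab (memory st) 4 (s * n + top q) = dist e s (top q) := hdist s (top q).
rewrite sRE.
pose I1 (i a b : nat) (m : nat -> nat) := [/\ a = iter i par q, same_tabs (memory st) m,
  m 0 = size R & forall k, k < i -> m (size R - k) = nth ord0 R k].
apply: (wp_mono (wp_for_const (I := I1) (tb := 60) _ _ _)) => //.
- by split => // j i; rewrite tab_low //; lia.
- move=> i s1; sim => hi ag1 ri [ha hm h0 hk].
  have e0 : regs s1 0 = B by rewrite ag1.
  have e11 : regs s1 11 = size R by rewrite ag1.
  wps; sim; rewrite e0 e11 ri ha.
  have lo : size R - i < B by lia.
  have st1 := select_same hm stab; have [[_ _ [htop1 _] _ _] _ hpar1 _] := st1.
  have tE : tab (memory s1) 2 (iter i par q) = nth ord0 R i.
    rewrite hit // htop1 ?code_lt // -topE ?code_lt //.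
    by rewrite (drop_nth ord0) // top_code.
  rewrite tE tab_low // hpar1; split; [lia | by agr |]; split => //.
  + by move=> j k; rewrite tab_low.
  + by rewrite updateE; case: eqP => [h|_]; [lia | exact: h0].
  + move=> k hk'; rewrite updateE; case: eqP => [h|nk].
      by have -> : k = i by lia.
    by apply: hk; lia.
- move=> s1 t1; sim => -[ht1 ag1 [ha hm h0 hk]]; split => //.
  + have : size R * 67 <= n * 67 by rewrite leq_mul2r sRn orbT.
    lia.
  + by agr; rewrite ag1; [upd | lia].
Qed.

Lemma select_spec st best :
  globals st -> select_tabs (memory st) -> 3 + n < B -> regs st 5 = s -> regs st 8 = best ->
  out_ok best (memory st) ->
  wp select st (fun st' t => exists best', [/\ t <= N * (n * 210 + 700) + 5, agree 7 st st',
    same_tabs (memory st) (memory st'), regs st' 8 = best' & 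
    [/\ best' <= best, out_ok best' (memory st') &
     forall q, q < N -> D q < n -> best' <= maxn (D q) (rest g e M q)]]).
Proof.
move=> G stab hB r5 r8 out0; have [g0 g1 g2 g3 g4] := G; rewrite /select.
pose I1 (i a b : nat) (m : nat -> nat) := [/\ same_tabs (memory st) m, a <= best,
  out_ok a m & forall q, q < i -> D q < n -> a <= maxn (D q) (rest g e M q)].
apply: (wp_mono (wp_for_const (I := I1) (tb := n * 210 + 690) _ _ _)) => //.
- by rewrite r8.
- move=> q s1; rewrite g4 => qN ag1 rq [hm ha ho hq].
  have G1 := globals_agree (isT : 5 <= 7) ag1 G; have [e0 e1 _ _ _] := G1.
  have stab1 := select_same hm stab; have [_ hD _ _] := stab1.
  have last_ (a : nat) m : a <= regs s1 8 -> same_tabs (memory s1) m -> out_ok a m ->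
    (D q < n -> a <= maxn (D q) (rest g e M q)) -> I1 q.+1 a 0 m.
    move=> h1 h2 h3 h4; split => //.
    + by move=> j i; rewrite h2 hm.
    + exact: leq_trans ha.
    + move=> q'; rewrite ltnS leq_eqVlt => /orP [/eqP -> //|hq'] hD'.
      exact: leq_trans h1 (hq _ hq' hD').
  apply: wp_if; sim; rewrite e0 e1 rq hD => hDq; wps; sim; last first.
    split; [lia | by agr |]; apply: last_ => //; lia.
  rewrite e0 rq hD.
  have G2 : globals (State (update (regs s1) 10 (D q)) (memory s1)) by apply: globals_upd.
  apply: (wp_mono (get_rest_spec G2 stab1 _ qN _)) => //.
  move=> s2 t2 [ht2 ag2 /= hm2 h10].
  have G3 := globals_agree (isT : 5 <= 9) ag2 G2.
  have a5 : regs s2 5 = s by rewrite ag2 //= updateE /= ag1.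
  have a7 : regs s2 7 = q by rewrite ag2.
  have a8 : regs s2 8 = regs s1 8 by rewrite ag2.
  apply: wp_if; sim; rewrite h10 a8 => hlt; wps; sim; last first.
    split; [lia | by agr; rewrite ag2; [upd | lia] |].
    by rewrite a8 hm2; apply: last_.
  have [R [HR cR hc hit]] := D_attained qN hDq.
  have G4 : globals (State (update (regs s2) 8 (regs s2 10)) (memory s2)) by apply: globals_upd.
  have stab2 : select_tabs (memory s2) by rewrite hm2.
  apply: (wp_mono (output_spec G4 stab2 hB _ _ HR cR hit)) => //.
  move=> s3 t3 [ht3 ag3 /= hm3 h0 hi].
  have a83 : regs s3 8 = maxn (D q) (rest g e M q) by rewrite ag3.
  split; first lia.
    by agr; rewrite ag3 /= ?updateE; [upd; rewrite ag2; [upd | lia] | lia].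
  rewrite a83; apply: last_ => //.
  + by rewrite ltnW.
  + by move=> j i; rewrite hm3 hm2.
  + move=> _; exists s, R; split => //; rewrite ecc_val // cR.
    by rewrite geq_max !leq_max hc leqnn orbT.
- move=> s1 t1; rewrite g4 => -[ht1 ag1 [hm ha ho hq]].
  by exists (regs s1 8); split => //; lia.
Qed.

End Select.
End Source.
End Passes.

(** * The complete program *)

Definition main_loop : prog :=
  Seq (Assign 6 (Reg 1))
      (For 5 1
        (Seq reset
        (Seq begin_source
        (Seq (for_trans relax_reach)
        (Seq (for_trans relax_cost)
        (Seq (Assign 8 (Reg 6))
        (Seq select
             (Assign 6 (Reg 8))))))))).

Definition mesp : prog :=
  Seq setup (Seq fill_mul (Seq fill_div (Seq fill_top
 (Seq dist_init (Seq dist_relax (Seq fill_wdist main_loop)))))).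

Section Correctness.

Variables (n' g B : nat) (e : rel 'I_n'.+1) (nb : 'I_n'.+1 -> seq 'I_n'.+1).
Local Notation n := n'.+1.
Local Notation T := 'I_n.
Local Notation N := (n ^ g.+1).
Local Notation P := (n ^ g).
Local Notation tab := (tab B).
Local Notation frame := (frame B).
Local Notation globals := (globals n' g B).
Local Notation code := (code n' g).
Local Notation tables_ok := (tables_ok g B e).
Local Notation mtab := (mtab (n' := n') B).
Local Notation out_ok := (out_ok e).

Hypotheses (e_sym : symmetric e) (e_irr : irreflexive e)
  (e_conn : forall u v, connect e u v) (nbP : adjacency_lists e nb).
Hypothesis gap : proj_gap_le e g.
Hypothesis hB : 3 + n < B.

Definition source_time : nat :=
  N * (n * 300 + 60) + 5 + (g.+1 * 70 + n * 520 + 60) +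
  (n * (n * 1600 + 12) + 5 + degsum nb * (P * (n * 600 + 305) + 5)) +
  (n * (n * 1600 + 12) + 5 + degsum nb * (P * (n * 500 + 500) + 5)) +
  (N * (n * 210 + 700) + 5) + 10.

Lemma main_loop_spec st : globals st -> tables_ok (memory st) ->
  wp main_loop st (fun st' t => t <= n * (source_time + 7) + 10 /\
    exists best, out_ok best (memory st') /\
    forall (s : T) R, rpath e s R -> best <= ecc e [set u in R]).
Proof.
move=> G tok; have [g0 g1 g2 g3 g4] := G; rewrite /main_loop; wps; sim; rewrite g1.
pose I1 (i a b : nat) (m : nat -> nat) := [/\ tables_ok m, out_ok a m &
  forall (s : T) R, s < i -> rpath e s R -> a <= ecc e [set u in R]].
apply: (wp_mono (wp_for_const (I := I1) (tb := source_time) _ _ _)) => //.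
- by split => //; move=> /= h; exfalso; move: h; rewrite updateE /= ltnn.
- move=> i s1; sim; rewrite g1 => hi ag1 ri [tok1 out1 opt1].
  have G1 : globals s1.
    by apply: (globals_agree (isT : 5 <= 5) _ G); agr; rewrite ag1; [upd | lia].
  pose s : T := Ordinal hi.
  set best := regs s1 6 in out1 opt1.
  wps; apply: (wp_mono (reset_spec G1 tok1)) => s2 t2 [ht2 ag2 fr2 h2].
  have G2 := globals_agree (isT : 5 <= 7) ag2 G1.
  have tok2 : tables_ok (memory s2) by apply: (tables_frame6 _ fr2).
  have out2 := out_frame e_conn hB fr2 out1.
  have r52 : regs s2 5 = s by rewrite ag2.
  wps; apply: (wp_mono (begin_source_spec G2 tok2 r52 h2)) => s3 t3 [ht3 ag3 fr3 h3].
  have G3 := globals_agree (isT : 5 <= 7) ag3 G2.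
  have tok3 : tables_ok (memory s3) by apply: (tables_frame6 _ fr3).
  have out3 := out_frame e_conn hB fr3 out2.
  have r53 : regs s3 5 = s by rewrite ag3.
  wps; apply: (wp_mono (reach_spec e_irr e_conn nbP G3 tok3 r53 (fun q hq => (h3 q hq).2))).
  move=> s4 t4 [ht4 ag4 fr4 Mle Matt].
  have G4 := globals_agree (isT : 5 <= 7) ag4 G3.
  have tok4 : tables_ok (memory s4) by apply: (tables_frame6 _ fr4).
  have out4 := out_frame e_conn hB fr4 out3.
  have r54 : regs s4 5 = s by rewrite ag4.
  pose M := mtab (memory s4).
  have D4 q : q < N -> tab (memory s4) 7 q = if q == start n' g s then 0 else n.
    by move=> hq; rewrite (fr4.2) // (h3 q hq).1.
  wps; apply: (wp_mono (cost_spec (M := M) e_irr e_conn nbP G4 tok4 r54 _ D4)) => //.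
  move=> s5 t5 [ht5 ag5 [fr5 _ D0 Dsat Dpar]].
  have G5 := globals_agree (isT : 5 <= 7) ag5 G4.
  have tok5 : tables_ok (memory s5) by apply: (tables_frame6 _ fr5).
  have out5 := out_frame e_conn hB fr5 out4.
  have r55 : regs s5 5 = s by rewrite ag5.
  have r65 : regs s5 6 = best by rewrite ag5 // ag4 // ag3 // ag2.
  wps; sim.
  pose D := tab (memory s5) 7; pose par := tab (memory s5) 8.
  have stab : select_tabs g B e M D par (memory s5).
    by split => // q x; rewrite /M /mtab (fr5.2).
  have ev := ecc_value e_sym e_irr e_conn gap Mle Matt.
  have att := @D_attained n' g e s M D par Dpar.
  have G5' : globals (State (update (regs s5) 8 (regs s5 6)) (memory s5)) by apply: globals_upd.
  apply: (wp_mono (select_spec (best := best) e_conn att ev G5' stab hB _ _ out5)) => //.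
  move=> s6 t6 [best' [ht6 ag6 st6 r8 [hb out6 opt6]]]; wps; sim; rewrite r8.
  split; first by rewrite /source_time; lia.
    agr; rewrite ag6 /=; last by lia.
    by upd; rewrite ag5; [rewrite ag4; [rewrite ag3; [rewrite ag2|]|]|]; lia.
  split.
  + by apply: (tables_frame (js := [::])) tok5 => // j k _ _; apply: st6.
  + exact: out6.
  + move=> s' R; rewrite ltnS leq_eqVlt => /orP [/eqP ss|hs] H; last first.
      exact: leq_trans hb (opt1 _ _ hs H).
    have ss' : s' = s by apply: val_inj.
    subst s'; rewrite ev //.
    (* Optimality: the window of [R] was among the candidates, with a cost at most that of [R] and
       the same [rest]. *)
    have hc : D (code s R) <= pcost g e M s R.
      apply: (D_le_pcost e_sym e_irr e_conn gap Mle Matt D0 _ H) => q w qN Dq tr.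
      exact: Dsat.
    have hcn := leq_ltn_trans hc (pcost_lt e_sym e_irr e_conn gap Mle Matt H).
    apply: leq_trans (opt6 _ (code_lt _ _ _) hcn) _.
    by rewrite geq_max !leq_max hc leqnn orbT.
- move=> s1 t1; sim; rewrite g1 => -[ht1 ag1 [_ out1 opt1]]; split; first lia.
  by exists (regs s1 6); split => // s R; apply: opt1.
Qed.

Definition total_time : nat :=
  g * (n * 12 + 20) + n * 12 + 60 + (N * 40 + 20) + (N * 300 + P * 20 + 20) +
  (N * 60 + n * 80 + 20) + (n * (n * 320) + n * 20 + 20) +
  (n * (n * (degsum nb * 407 + n * 67 + 12) + 12) + 5) +
  (N * (n * (g.+1 * 350 + 320) + 12) + 5) + (n * (source_time + 7) + 10).

Lemma mesp_spec st :
  memory st 0 = n -> memory st 2 = g -> memory st (3 + n) = B -> input_ok B nb (memory st) ->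
  wp mesp st (fun st' t => t <= total_time /\
    exists best, out_ok best (memory st') /\
    forall (s : T) R, rpath e s R -> best <= ecc e [set u in R]).
Proof.
move=> m0 m2 mB inp; rewrite /mesp.
wps; apply: (wp_mono (setup_spec m0 m2 mB)) => s1 t1 [ht1 G1 hm1].
rewrite -hm1 in inp.
wps; apply: (wp_mono (fill_mul_spec G1)) => s2 t2 [ht2 ag2 fr2 hmul2].
have G2 := globals_agree (isT : 5 <= 5) ag2 G1; have inp2 := input_frame fr2 inp.
wps; apply: (wp_mono (fill_div_spec G2 hmul2)) => s3 t3 [ht3 ag3 fr3 hdiv3].
have G3 := globals_agree (isT : 5 <= 5) ag3 G2; have inp3 := input_frame fr3 inp2.
have hmul3 := mul_frame (isT : 0 \notin [:: 1]) fr3 hmul2.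
wps; apply: (wp_mono (fill_top_spec G3)) => s4 t4 [ht4 ag4 fr4 htop4 hmulp4].
have G4 := globals_agree (isT : 5 <= 5) ag4 G3; have inp4 := input_frame fr4 inp3.
have hmul4 := mul_frame (isT : 0 \notin [:: 2; 3]) fr4 hmul3.
have hdiv4 := div_frame (isT : 1 \notin [:: 2; 3]) fr4 hdiv3.
wps; apply: (wp_mono (dist_init_spec G4 hmul4)) => s5 t5 [ht5 ag5 fr5 hd5].
have G5 := globals_agree (isT : 5 <= 5) ag5 G4; have inp5 := input_frame fr5 inp4.
have hmul5 := mul_frame (isT : 0 \notin [:: 4]) fr5 hmul4.
wps; apply: (wp_mono (dist_relax_spec e_irr e_conn nbP G5 hmul5 inp5 hd5)) => s6 t6 [ht6 ag6 fr6 hd6].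
have G6 := globals_agree (isT : 5 <= 5) ag6 G5.
have hmul6 := mul_frame (isT : 0 \notin [:: 4]) fr6 hmul5.
have hdiv6 := div_frame (isT : 1 \notin [:: 4]) fr6 (div_frame (isT : 1 \notin [:: 4]) fr5 hdiv4).
wps; apply: (wp_mono (fill_wdist_spec G6 hmul6 hdiv6 hd6)) => s7 t7 [ht7 ag7 fr7 hw7].
have G7 := globals_agree (isT : 5 <= 5) ag7 G6.
have tok7 : tables_ok (memory s7).
  split => //.
  - exact: mul_frame (isT : 0 \notin [:: 5]) fr7 hmul6.
  - exact: div_frame (isT : 1 \notin [:: 5]) fr7 hdiv6.
  - by split => [q hq|k hk]; rewrite (fr7.2) // (fr6.2) // (fr5.2) //; [apply: htop4 | apply: hmulp4].
  - exact: dist_frame (isT : 4 \notin [:: 5]) fr7 hd6.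
apply: (wp_mono (main_loop_spec G7 tok7)) => s8 t8 [ht8 H]; split => //.
rewrite /total_time; lia.
Qed.

End Correctness.

(** * The encoded graph in the initial memory *)

Section Input.

Variables (n' : nat) (nb : 'I_n'.+1 -> seq 'I_n'.+1) (m g : nat).
Local Notation n := n'.+1.
Local Notation T := 'I_n.

Let sh := [seq size (nb u) | u <- enum T].
Let mem a := nth 0 (encode m g nb) a.

Lemma encodeE : encode m g nb = [:: n; m; g] ++
  [seq n + 4 + sumn (take i sh) | i <- iota 0 n.+1] ++ flatten [seq [seq val v | v <- nb u] | u <- enum T].
Proof.
rewrite /encode; have -> // : shape [seq [seq val v | v <- nb u] | u <- enum T] = sh.
by rewrite /shape -map_comp; apply: eq_map => u /=; rewrite size_map.
Qed.

Lemma size_sh : size sh = n.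
Proof. by rewrite size_map size_enum_ord. Qed.

Lemma nth_sh (v : T) : nth 0 sh v = size (nb v).
Proof. by rewrite (nth_map v) ?size_enum_ord // nth_ord_enum. Qed.

Lemma encode_off i : i <= n -> mem (3 + i) = n + 4 + sumn (take i sh).
Proof.
move=> hi; rewrite /mem encodeE; set off := map _ (iota _ _).
have sz : size off = n.+1 by rewrite size_map size_iota.
have <- : nth 0 off i = n + 4 + sumn (take i sh).
  by rewrite (nth_map 0) ?size_iota // nth_iota.
move: off sz => off sz; rewrite nth_cat ltnNge leq_addr /= addKn nth_cat.
by rewrite sz ltnS hi.
Qed.

Lemma sumn_take_sh (v : T) : sumn (take v.+1 sh) = sumn (take v sh) + size (nb v).
Proof. by rewrite (take_nth 0) ?size_sh // sumn_rcons nth_sh. Qed.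

Lemma sumn_take_le i : sumn (take i sh) <= sumn sh.
Proof. by rewrite -{2}(cat_take_drop i sh) sumn_cat leq_addr. Qed.

Lemma encode_list (v : T) p : p < size (nb v) ->
  mem (n + 4 + sumn (take v sh) + p) = nth ord0 (nb v) p.
Proof.
move=> hp; rewrite /mem encodeE; set off := map _ (iota _ _).
have sz : size off = n.+1 by rewrite size_map size_iota.
move: off sz => off sz; rewrite nth_cat ltnNge /=.
have -> : 2 < n + 4 + sumn (take v sh) + p by lia.
rewrite nth_cat sz ltnNge /=.
(* Three header cells and [n + 1] offsets precede the lists, which therefore start at address
   [n + 4]. *)
have -> : n + 4 + sumn (take v sh) + p - 3 - n.+1 = sumn (take v sh) + p by lia.
have -> : n < n + 4 + sumn (take v sh) + p - 3 by lia.
set L := [seq _ | u <- enum T].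
have shL : shape L = sh by rewrite /shape -map_comp; apply: eq_map => u /=; rewrite size_map.
rewrite -[sumn _ + p]/(flatten_index sh v p) nth_flatten shL.
rewrite flatten_indexKl ?nth_sh // flatten_indexKr ?nth_sh //.
rewrite (nth_map v) ?size_enum_ord // nth_ord_enum.
by rewrite (nth_map ord0).
Qed.

Lemma encode_input : input_ok (n + 4 + sumn sh) nb mem.
Proof.
split; first lia.
- move=> v; have vn := ltn_ord v.
  have -> : 4 + v = 3 + v.+1 by lia.
  by rewrite !encode_off ?sumn_take_sh ?addnA // ltnW.
- move=> v p hp; have vn := ltn_ord v; rewrite encode_off ?(ltnW vn) //; split.
    by have := sumn_take_le v.+1; rewrite sumn_take_sh; lia.
  exact: encode_list.
Qed.

Lemma encode_end : mem (3 + n) = n + 4 + sumn sh.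
Proof. by rewrite encode_off // take_oversize ?size_sh. Qed.

End Input.

(** * The sum of degrees and the number of edges *)

Section Degrees.

Variables (n' : nat) (e : rel 'I_n'.+1) (nb : 'I_n'.+1 -> seq 'I_n'.+1).
Local Notation n := n'.+1.
Local Notation T := 'I_n.
Hypotheses (e_irr : irreflexive e) (nbP : adjacency_lists e nb).

Lemma degsumE : degsum nb = \sum_(v : T) size (nb v).
Proof. by rewrite /degsum big_mkord; apply: eq_bigr => v _; rewrite inord_val. Qed.

Lemma degsum_pairs : degsum nb = #|[pred uv : T * T | e uv.1 uv.2]|.
Proof.
rewrite degsumE -sum1_card (eq_bigl (fun p : T * T => xpredT p.1 && e p.1 p.2)) //.
rewrite -(pair_big_dep xpredT e (fun _ _ => 1)) /=; apply: eq_bigr => u _.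
by have [un hn] := nbP u; rewrite -(card_uniqP un) -sum1_card; apply: eq_bigl => v; rewrite hn.
Qed.

(** Adjacent ordered pairs are grouped by their underlying edge; without loops a group contains at
    most the two orientations. *)
Lemma degsum_edges : degsum nb <= 2 * #|edges e|.
Proof.
rewrite degsum_pairs; set A := [pred uv : T * T | e uv.1 uv.2].
pose f (uv : T * T) := [set uv.1; uv.2].
rewrite -[#|A|]sum1_card (partition_big f (fun y => y \in edges e)) /=; last first.
  by move=> p hp; apply/imsetP; exists p; rewrite // inE.
rewrite mulnC -sum_nat_const; apply: leq_sum => y /imsetP [[a b] _ ->].
rewrite sum1_card; apply: (@leq_trans #|[set (a, b); (b, a)]|); last by rewrite cards2; case: eqP.
apply: subset_leq_card; apply/subsetP => -[c d]; rewrite unfold_in /= => /andP [ecd /eqP h].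
have {}ecd : e c d := ecd.
have ncd : c != d by apply/eqP => cd; rewrite cd e_irr in ecd.
have hc : c \in [set a; b] by rewrite -[[set a; b]]h !inE eqxx.
have hd : d \in [set a; b] by rewrite -[[set a; b]]h !inE eqxx orbT.
move: hc hd ncd; rewrite !inE !xpair_eqE.
by case/orP => /eqP ->; case/orP => /eqP ->; rewrite ?eqxx ?orbT.
Qed.

Lemma degsum_le_sqr : degsum nb <= n * n.
Proof.
rewrite degsumE; apply: (@leq_trans (\sum_(v : T) n)).
  by apply: leq_sum => v _; have [un _] := nbP v; have := max_card (mem (nb v)); rewrite (card_uniqP un) card_ord.
by rewrite sum_nat_const card_ord.
Qed.

(** No vertex is isolated. This absorbs the work not tied to edges, such as [n ^ (g + 3)] for
    resetting the tables, into the bound [n ^ (g + 2)] times the sum of degrees. *)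
Lemma degsum_ge : (forall u v, connect e u v) -> 1 < n -> n <= degsum nb.
Proof.
move=> e_conn hn; rewrite degsumE -{1}(card_ord n) -sum1_card; apply: leq_sum => v _.
have [u vu] : exists u : T, v != u.
  case: (v =P ord0) => [->|/eqP h]; last by exists ord0.
  by exists (inord 1); apply/eqP => /(congr1 val); rewrite /= inordK.
have /connectP [[|a w] /= pw lw] := e_conn v u; first by rewrite lw eqxx in vu.
case/andP: pw => eva _; have [_ hn'] := nbP v; rewrite -hn' in eva.
by case: (nb v) eva.
Qed.

End Degrees.

(** From [n <= D], [g <= n] and [0 < P], each monomial of the running time is at most
    [n * n * P * D]. The instances of [mono] state this, and what remains is linear in the
    monomials. The factor [g] from the window distances is absorbed through [g <= n <= D]. *)
Lemma time_bound n P D g N src : 0 < n -> 0 < P -> n <= D -> g <= n -> N = n * P ->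
  src = N * (n * 300 + 60) + 5 + (g.+1 * 70 + n * 520 + 60) +
    (n * (n * 1600 + 12) + 5 + D * (P * (n * 600 + 305) + 5)) +
    (n * (n * 1600 + 12) + 5 + D * (P * (n * 500 + 500) + 5)) +
    (N * (n * 210 + 700) + 5) + 10 ->
  g * (n * 12 + 20) + n * 12 + 60 + (N * 40 + 20) + (N * 300 + P * 20 + 20) +
  (N * 60 + n * 80 + 20) + (n * (n * 320) + n * 20 + 20) +
  (n * (n * (D * 407 + n * 67 + 12) + 12) + 5) +
  (N * (n * (g.+1 * 350 + 320) + 12) + 5) + (n * (src + 7) + 10)
  <= 100 * 150 * (n * n * P * D).
Proof.
move=> n0 P0 nD gn -> -> {N src}.
have mono a b c d : a <= n -> b <= n -> c <= P -> d <= D -> a * b * c * d <= n * n * P * D.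
  by move=> *; rewrite !leq_mul.
have D0 : 0 < D by apply: leq_trans nD.
have gD : g <= D by apply: leq_trans nD.
have := mono n n P n; have := mono n n P g; have := mono n n P 1; have := mono n 1 P 1.
have := mono 1 1 P 1; have := mono n n 1 D; have := mono n n 1 n; have := mono n n 1 1.
have := mono n g 1 1; have := mono n 1 1 1; have := mono g 1 1 1; have := mono 1 1 1 1.
have := mono n 1 P D; have := mono n 1 1 D; have := mono n 1 P g.
rewrite !leqnn n0 P0 nD gn D0 gD !muln1 !mul1n.
do 15 move=> /(_ isT isT isT isT) ?.
lia.
Qed.

Theorem theorem4 :
  exists (A : prog) (C n0 : nat),
  forall (n : nat) (e : rel 'I_n) (nb : 'I_n -> seq 'I_n) (g : nat),
    0 < n -> symmetric e -> irreflexive e ->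
    (forall u v : 'I_n, connect e u v) ->
    adjacency_lists e nb ->
    is_proj_gap e g ->
    let m := #|edges e| in
    exists (s : state) (t : nat),
      [/\ exec A (init (encode m g nb)) s t,
          exists2 P : seq 'I_n, min_ecc_shortest_path e P & outputs s P &
          n0 <= n ->
            [/\ 2 <= g -> t <= C * n ^ (g + 4),
                g = 1 -> t <= C * (n ^ 3 * m) &
                g = 0 -> t <= C * (n ^ 2 * m)]].
Proof.
(* The factor 2 passes from the sum of degrees to [m]. With a single vertex [m = 0] and the bounds
   containing [m] vanish, hence the threshold 2. *)
exists mesp, (2 * (100 * 150)), 2 => -[//|n'] e nb g _ e_sym e_irr e_conn nbP [gap gmin] m.
have inp := encode_input nb m g; have mB := encode_end nb m g.
set B := n'.+1 + 4 + _ in inp mB.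
have hB : 3 + n'.+1 < B by rewrite /B; lia.
(* All distances are below [n], so the gap condition holds vacuously for the value [n], and [g] is
   the least admissible value. *)
have gn : g <= n'.+1.
  apply: gmin => P _ x i k _ _ v PrxP _ _.
  by have := dist_lt_card (e_conn (v i) (v k)); rewrite card_ord; lia.
have [s [t [E [ht [best [out opt]]]]]] :=
  @mesp_spec n' g B e nb e_sym e_irr e_conn nbP gap hB (init (encode m g nb)) erefl erefl mB inp.
exists s, t; split => //.
(* A one-vertex path already has eccentricity below [n], so [out_ok] is not vacuous and some path
   was written. *)
- have best_lt : best < n'.+1.
    apply: leq_ltn_trans (opt ord0 [:: ord0] (rpath1 _ _)) _.
    rewrite ecc_mind; apply: ltn_bigmax => // x _.
    by have := mind_lt_card e_conn x (mem_head ord0 [::]); rewrite card_ord.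
  have [s0 [R [HR hR m0 mi]]] := out best_lt.
  (* Paths in the proof run backwards while the theorem reads them forwards; eccentricity depends
     only on the vertex set. *)
  have revE (Q : seq 'I_n'.+1) : [set u in rev Q] = [set u in Q].
    by apply/setP => u; rewrite !inE mem_rev.
  exists (rev R).
    split; first exact: (rpath_shortest e_conn HR).
    move=> Q /shortest_rpath [s1 HQ]; rewrite revE -[[set u in Q]]revE.
    exact: leq_trans hR (opt _ _ HQ).
  rewrite /outputs; apply: (@eq_from_nth _ 0); first by rewrite size_mkseq /= size_map.
  move=> i; rewrite size_mkseq => hi; rewrite nth_mkseq //.
  case: i hi => [|i] hi /=; first by rewrite m0 size_rev.
  rewrite ltnS size_rev in hi.
  rewrite (nth_map ord0) ?size_rev // nth_rev //.
  have := mi (size R - i.+1); have -> : size R - (size R - i.+1) = i.+1 by lia.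
  by apply; lia.
- move=> hn; set n := n'.+1 in hn *; set D := degsum nb.
  have nD : n <= D by apply: degsum_ge.
  have P0 : 0 < n ^ g by rewrite expn_gt0.
  have {}ht : t <= 100 * 150 * (n * n * n ^ g * D).
    apply: leq_trans ht _; rewrite /total_time.
    by apply: time_bound => //; rewrite expnS.
  have Dm : D <= 2 * m := degsum_edges e_irr nbP.
  have DE : 100 * 150 * (n * n * n ^ g * D) <= 2 * (100 * 150) * (n * n * n ^ g * m).
    have := leq_mul (leqnn (n * n * n ^ g)) Dm; lia.
  split => hg.
  + apply: leq_trans ht _; rewrite -mulnA.
    have -> : n ^ (g + 4) = n * n * n ^ g * (n * n) by rewrite expnD !expnS expn0; lia.
    have h := leq_mul (leqnn (n * n * n ^ g)) (degsum_le_sqr nbP : D <= n * n).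
    lia.
  + apply: leq_trans ht (leq_trans DE _); rewrite hg !expnS expn0 !muln1; lia.
  + apply: leq_trans ht (leq_trans DE _); rewrite hg !expnS expn0 !muln1; lia.
Qed.
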